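(* Let $d\ge4$ and let $R\in\mathbb N_+$ satisfy $\min_{1\le i\le d} n_i\ge R^2>\max_{1\le j\le d} r_j$ and $\min_{1\le j\le d} r_j\ge R$. Then for any $\tau\in S_d$ there is a Lebesgue-measure-zero set $\mathcal N\subset\mathcal U^d_{\vec r,\vec n,\tau}$ such that for every $\vec{\mathbf u}\in\mathcal U^d_{\vec r,\vec n,\tau}\setminus\mathcal N$, the Ring Recovery Algorithm, run with the integer $R$ and with exact access to the entries of $\mathbf T=\varphi(\vec{\mathbf u},\tau)$, returns an element of $\mathcal CS^d_{\mathrm{TR}}(\tau)$.
   Context: **Tensor ring format.** $d$ is a positive integer, $S_d$ is the group of permutations of $\{1,\dots,d\}$, and $\vec n=(n_1,\dots,n_d)$, $\vec r=(r_1,\dots,r_d)$ are vectors of positive integers. Arguments of $\tau$ and subscripts of $r$ are read modulo $d$ (so $\tau(d+1)=\tau(1)$, $r_{d+1}=r_1$). For $\tau\in S_d$ let $\mathcal U^d_{\vec r,\vec n,\tau}=\bigoplus_{i=1}^d\mathbb R^{r_{\tau^{-1}(i)}\times n_i\times r_{\tau^{-1}(i)+1}}$, a Euclidean space with Lebesgue measure. For $\vec{\mathbf u}=(\mathbf u^{[1]},\dots,\mathbf u^{[d]})$ in it, write $\mathbf u^{[i]}(x)=\mathbf u^{[i]}(:,x,:)\in\mathbb R^{r_{\tau^{-1}(i)}\times r_{\tau^{-1}(i)+1}}$. The tensor $\varphi(\vec{\mathbf u},\tau)\in\mathbb R^{n_1\times\cdots\times n_d}$ has entries $$\varphi(\vec{\mathbf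 u},\tau)(x_1,\dots,x_d)=\mathrm{tr}\big(\mathbf u^{[\tau(1)]}(x_{\tau(1)})\,\mathbf u^{[\tau(2)]}(x_{\tau(2)})\cdots\mathbf u^{[\tau(d)]}(x_{\tau(d)})\big).$$ **Equivalence class.** $\mathcal CS^d_{\mathrm{TR}}(\tau)=\{\tau\circ\alpha^k\circ\beta^\ell:\ k\in\{0,1,\dots,d-1\},\ \ell\in\{0,1\}\}$, where $\alpha(j)=j+1$ (mod $d$) and $\beta(j)=d+1-j$. **Matricizations.** Given distinct $i_1,\dots,i_4$ and fixed $y_i\in\{1,\dots,n_i\}$ for $i\notin\{i_1,\dots,i_4\}$, let $A(x_{i_1},x_{i_2},x_{i_3},x_{i_4})$ be the entry of the tensor whose $i_s$-th coordinate is $x_{i_s}$ ($1\le s\le4$) and whose $i$-th coordinate is $y_i$ for all other $i$. Define $M_{(i_1,i_2),(i_3,i_4)}\in\mathbb R^{(n_{i_1}n_{i_2})\times(n_{i_3}n_{i_4})}$, $M_{(i_1,i_3),(i_2,i_4)}\in\mathbb R^{(n_{i_1}n_{i_3})\times(n_{i_2}n_{i_4})}$, $M_{(i_1,i_4),(i_2,i_3)}\in\mathbb R^{(n_{i_1}n_{i_4})\times(n_{i_2}n_{i_3})}$ by $M_{(i_1,i_2),(i_3,i_4)}((x_{i_1},x_{i_2}),(x_{i_3},x_{i_4}))=M_{(i_1,i_3),(i_2,i_4)}((x_{i_1},x_{i_3}),(x_{i_2},x_{i_4}))=M_{(i_1,i_4),(i_2,i_3)}((x_{i_1},x_{i_4}),(x_{i_2},x_{i_3}))=A(x_{i_1},x_{i_2},x_{i_3},x_{i_4})$.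 $\sigma_k(M)$ denotes the $k$-th largest singular value of $M$. **Four-Index Algorithm.** Input: $i_1,i_2,i_3,i_4$, an integer $R\in\mathbb N_+$, and an oracle for the entries of $\mathbf T$. Sample (i.e. pick arbitrarily) $y_i\in\{1,\dots,n_i\}$ for $i\notin\{i_1,\dots,i_4\}$; form the three matrices above from $\mathbf T$. Compare $a=\sigma_{R^4}(M_{(i_1,i_2),(i_3,i_4)})$, $b=\sigma_{R^4}(M_{(i_1,i_3),(i_2,i_4)})$, $c=\sigma_{R^4}(M_{(i_1,i_4),(i_2,i_3)})$. If $a>\max\{b,c\}$ return $(i_1,i_3,i_2,i_4)$; if $b>\max\{a,c\}$ return $(i_1,i_2,i_3,i_4)$; if $c>\max\{a,b\}$ return $(i_1,i_2,i_4,i_3)$. **Ring Recovery Algorithm.** Input: $R\in\mathbb N_+$ and an oracle for the entries of $\mathbf T$. Two 4-tuples are called equivalent if they differ by a rotation and/or a reversal. 1. Let $(i_1,i_2,i_3,i_4)$ be the output of the Four-Index Algorithm on $1,2,3,4$. 2. For $t=4,\dots,d-1$: set $j_{\min}=1$, $j_{\max}=t+1$. While $j_{\max}-j_{\min}\ge2$: (i) if $j_{\max}-j_{\min}\ge3$, set $j_1=j_{\min}$, $j_2=j_{\min}+\lfloor\frac13(j_{\max}-j_{\min})\rfloor$, $j_3=j_{\min}+\lfloor\frac23(j_{\max}-j_{\min})\rfloor$; else if $j_{\max}\le t$, set $j_1=j_{\min}$, $j_2=j_{\min}+1$, $j_3=j_{\max}$; else set $j_1=1$, $j_2=t-1$,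 $j_3=t$; (ii) run the Four-Index Algorithm on $t+1,i_{j_1},i_{j_2},i_{j_3}$; if its output is equivalent to $(i_{j_1},t+1,i_{j_2},i_{j_3})$, set $j_{\min}=j_1$, $j_{\max}=j_2$; else if it is equivalent to $(i_{j_1},i_{j_2},t+1,i_{j_3})$, set $j_{\min}=j_2$, $j_{\max}=j_3$; else set $j_{\min}=j_3$. After the while loop, replace $(i_1,\dots,i_t)$ by $(i_1,\dots,i_{j_{\min}},t+1,i_{j_{\max}},\dots,i_t)$ (if $j_{\max}=t+1$, then $t+1$ is appended at the end). 3. Return $\tau'\in S_d$ with $\tau'(j)=i_j$ for $1\le j\le d$. *)

(* Defs.v *)
From HB Require Import structures.
From mathcomp Require Import all_boot all_order all_fingroup all_algebra.
From mathcomp Require Import polyrcf.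
From mathcomp Require Import all_classical all_reals all_analysis.

Set Implicit Arguments.
Unset Strict Implicit.
Unset Printing Implicit Defensive.

Import Order.TTheory GRing.Theory Num.Theory.

Local Open Scope ring_scope.

(* Conventions.  The order of the tensor is d = m.+1, and the index set
   {1, ..., d} is 'I_m.+1, so that the label or position k of the text is the
   ordinal of value k - 1.  Hence j |-> j + 1 (mod d) is [ordS] and
   j |-> d + 1 - j is [rev_ord]. *)

(** Lebesgue outer measure on R^I, for I a nonempty finite type: infimum of the
    total volume over the countable coverings by closed boxes. A set has
    Lebesgue measure zero iff its outer measure is 0. *)
Section LebesgueOuterMeasure.
Local Open Scope classical_set_scope.
Context {R : realType} {I : finType}.

Definition box (a b : I -> R) : set (I -> R) :=
  [set x | forall i, a i <= x i <= b i].

Definition box_volume (a b : I -> R) : R := \prod_i (b i - a i).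

Definition lebesgue_outer_measure (A : set (I -> R)) : \bar R :=
  ereal_inf [set v : \bar R | exists a b : nat -> I -> R,
    [/\ forall k i, a k i <= b k i,
        A `<=` \bigcup_k box (a k) (b k) &
        v = (\sum_(0 <= k <oo) (box_volume (a k) (b k))%:E)%E]].

End LebesgueOuterMeasure.

Section SingularValues.
Context {R : realType}.

(* All real roots of P, in decreasing order, repeated with multiplicity. *)
Definition roots_with_mult (P : {poly R}) : seq R :=
  flatten [seq nseq (mup x P) x | x <- rev (rootsR P)].

(* Square roots of the eigenvalues of M^T M. If M has more columns than rows
   the list is padded with zeros: only its first min(k, l) entries are the
   singular values of M. *)
Definition singular_values k l (M : 'M[R]_(k, l)) : seq R :=
  [seq Num.sqrt x | x <- roots_with_mult (char_poly (M^T *m M))].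

(* The s-th largest singular value, s >= 1. *)
Definition sigma (s : nat) k l (M : 'M[R]_(k, l)) : R :=
  nth 0 (singular_values M) s.-1.

End SingularValues.

Lemma iter_ordS m k (i : 'I_m.+1) :
  iter k (@ordS m.+1) i = ((i + k) %% m.+1)%N :> nat.
Proof.
elim: k => [|k IH] /=; first by rewrite addn0 modn_small.
by rewrite IH addnS -[in LHS]addn1 modnDml addn1.
Qed.

Lemma iter_ordS_full m : iter m.+1 (@ordS m.+1) ord0 = ord0.
Proof. by apply: ord_inj; rewrite iter_ordS add0n modnn. Qed.

Section TensorRing.
Context {R : realType} {m : nat} (n r : 'I_m.+1 -> nat) (tau : 'S_m.+1).

(* The coordinates of the direct sum over i of the spaces of
   r_{tau^-1(i)} x n_i x r_{tau^-1(i)+1} arrays. *)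
Definition core_entry : finType :=
  {i : 'I_m.+1 &
    ('I_(r (tau^-1%g i)) * 'I_(n i) * 'I_(r (ordS (tau^-1%g i))))%type}.

Definition multi_index := forall i : 'I_m.+1, 'I_(n i).

Variable u : core_entry -> R.

Definition core (i : 'I_m.+1) (x : 'I_(n i)) :
    'M[R]_(r (tau^-1%g i), r (ordS (tau^-1%g i))) :=
  \matrix_(a, b) u (existT _ i (a, x, b)).

(* u^[tau(j)](x_{tau(j)}), cast along tau^-1 (tau j) = j. *)
Definition ring_core (x : multi_index) (j : 'I_m.+1) :
    'M[R]_(r j, r (ordS j)) :=
  castmx (congr1 r (permK tau j), congr1 (fun k => r (ordS k)) (permK tau j))
         (core (x (tau j))).

(* Product of the first k factors, starting at the first position. *)
Fixpoint ring_prod (x : multi_index) (k : nat) :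
    'M[R]_(r ord0, r (iter k (@ordS m.+1) ord0)) :=
  match k with
  | 0 => 1%:M
  | k'.+1 => ring_prod x k' *m ring_core x (iter k' (@ordS m.+1) ord0)
  end.

Definition tensor_ring (x : multi_index) : R :=
  \tr (castmx (erefl, congr1 r (iter_ordS_full m)) (ring_prod x m.+1)).

End TensorRing.

Section EquivalenceClass.
Context {m : nat}.

Definition rotation : 'S_m.+1 := perm (can_inj (@ordSK m.+1)).
Definition reflection : 'S_m.+1 := perm (@rev_ord_inj m.+1).

(* The group law of 'S_m.+1 satisfies (s * t) j = t (s j), so the element below
   is the composite tau o rotation^k o reflection^l. *)
Definition CS_TR (tau : 'S_m.+1) : {set 'S_m.+1} :=
  [set (reflection ^+ nat_of_ord l * rotation ^+ nat_of_ord k * tau)%g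
    | k : 'I_m.+1, l : 'I_2].

End EquivalenceClass.

Section Algorithms.
Context {R : realType} {m : nat} (n : 'I_m.+1 -> nat).
Variables (T : multi_index n -> R) (q : nat).

(* The slice A(x_{i1}, x_{i2}, x_{i3}, x_{i4}); the components of y at the four
   selected indices are overwritten. *)
Definition slice (y : multi_index n) (i1 i2 i3 i4 : 'I_m.+1)
    (x1 : 'I_(n i1)) (x2 : 'I_(n i2)) (x3 : 'I_(n i3)) (x4 : 'I_(n i4)) : R :=
  T (dfwith (dfwith (dfwith (dfwith y i1 x1) i2 x2) i3 x3) i4 x4).

(* Rows are indexed by pairs (a, b) and columns by pairs (c, d), through the
   enumeration of the two product types. *)
Definition pair_mx n1 n2 n3 n4 (A : 'I_n1 -> 'I_n2 -> 'I_n3 -> 'I_n4 -> R) :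
    'M[R]_(#|{: 'I_n1 * 'I_n2}|, #|{: 'I_n3 * 'I_n4}|) :=
  \matrix_(a, b) A (enum_val a).1 (enum_val a).2 (enum_val b).1 (enum_val b).2.

Definition mx12_34 y i1 i2 i3 i4 := pair_mx (@slice y i1 i2 i3 i4).
Definition mx13_24 y i1 i2 i3 i4 :=
  pair_mx (fun x1 x3 x2 x4 => @slice y i1 i2 i3 i4 x1 x2 x3 x4).
Definition mx14_23 y i1 i2 i3 i4 :=
  pair_mx (fun x1 x4 x2 x3 => @slice y i1 i2 i3 i4 x1 x2 x3 x4).

(* [None]: no strict maximum, so no output. *)
Definition four_index (y : multi_index n) (i1 i2 i3 i4 : 'I_m.+1) :
    option (seq 'I_m.+1) :=
  let a := sigma (q ^ 4) (mx12_34 y i1 i2 i3 i4) in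
  let b := sigma (q ^ 4) (mx13_24 y i1 i2 i3 i4) in
  let c := sigma (q ^ 4) (mx14_23 y i1 i2 i3 i4) in
  if Num.max b c < a then Some [:: i1; i3; i2; i4]
  else if Num.max a c < b then Some [:: i1; i2; i3; i4]
  else if Num.max a b < c then Some [:: i1; i2; i4; i3]
  else None.

Definition equiv4 (s t : seq 'I_m.+1) : bool :=
  [exists k : 'I_4, (t == rot k s) || (t == rot k (rev s))].

(* The positions j1, j2, j3 probed at stage t; positions are counted from 1. *)
Definition probes (t jmin jmax : nat) : nat * nat * nat :=
  if (3 <= jmax - jmin)%N then
    (jmin, jmin + (jmax - jmin) %/ 3, jmin + (2 * (jmax - jmin)) %/ 3)%N
  else if (jmax <= t)%N then (jmin, jmin.+1, jmax)
  else (1, t.-1, t)%N.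

(* The label t + 1 is the ordinal of value t. *)
Definition search_step (y : multi_index n) (t : nat) (s : seq 'I_m.+1)
    (jmin jmax : nat) : option (nat * nat) :=
  let: (j1, j2, j3) := probes t jmin jmax in
  let e : 'I_m.+1 := inord t in
  let i j := nth ord0 s j.-1 in
  if four_index y e (i j1) (i j2) (i j3) is Some o then
    Some (if equiv4 o [:: i j1; e; i j2; i j3] then (j1, j2)
          else if equiv4 o [:: i j1; i j2; e; i j3] then (j2, j3)
          else (j3, jmax))
  else None.

(* The algorithm is nondeterministic only through the fixed indices picked in
   each call of the Four-Index Algorithm: [Y c] is the pick of the call number
   c, and c counts the calls made so far. For a given Y at most one rule below
   applies at each point, and none applies once a call has had no output. *)
Variable Y : nat -> multi_index n.

(* [search t s c jmin jmax c' jmin' jmax']: the while loop of stage t, entered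
   with c, jmin, jmax, terminates with c', jmin', jmax'. *)
Inductive search (t : nat) (s : seq 'I_m.+1) :
    nat -> nat -> nat -> nat -> nat -> nat -> Prop :=
| search_exit c jmin jmax :
    (jmax - jmin < 2)%N -> search t s c jmin jmax c jmin jmax
| search_next c jmin jmax jmin1 jmax1 c' jmin' jmax' :
    (2 <= jmax - jmin)%N ->
    search_step (Y c) t s jmin jmax = Some (jmin1, jmax1) ->
    search t s c.+1 jmin1 jmax1 c' jmin' jmax' ->
    search t s c jmin jmax c' jmin' jmax'.

Definition insert_label (t : nat) (s : seq 'I_m.+1) (jmin jmax : nat) :
    seq 'I_m.+1 :=
  take jmin s ++ inord t :: drop jmax.-1 s.

(* [grow c t s s']: the for loop, entered at stage t with the list s, ends with
   the list s'. *)
Inductive grow : nat -> nat -> seq 'I_m.+1 -> seq 'I_m.+1 -> Prop :=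
| grow_exit c t s : (m.+1 <= t)%N -> grow c t s s
| grow_next c t s c' jmin jmax s' :
    (t < m.+1)%N ->
    search t s c 1 t.+1 c' jmin jmax ->
    grow c' t.+1 (insert_label t s jmin jmax) s' ->
    grow c t s s'.

Definition ring_recovery (tau' : 'S_m.+1) : Prop :=
  exists s0 s,
    [/\ four_index (Y 0) (inord 0) (inord 1) (inord 2) (inord 3) = Some s0,
        grow 1 4 s0 s &
        s = [seq tau' j | j <- enum 'I_m.+1]].

End Algorithms.

(* Main.v *)
Require Import Defs.
From HB Require Import structures.
From mathcomp Require Import all_boot all_order all_fingroup all_algebra.
From mathcomp Require Import polyrcf complex.
From mathcomp Require Import zify ring lra.
From mathcomp Require Import all_classical all_reals all_analysis.

Set Implicit Arguments.
Unset Strict Implicit.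
Unset Printing Implicit Defensive.

Import Order.TTheory GRing.Theory Num.Theory.
Import numFieldNormedType.Exports.

Local Open Scope ring_scope.

(** Let p_1, ..., p_4 be the positions on the ring of four labels. For each of the
    three ways to pair them, consider the corresponding matricization of a slice
    of the tensor.

    If the chords joining the two pairs do not cross, the ring can be cut at two
    bonds so that one pair lies on each side; the matricization then factors
    through a space whose dimension is the product of two bond dimensions, hence
    less than q ^ 4, and its singular value number q ^ 4 vanishes
    ([mxrank_low]). If the chords cross, the rank is at least q ^ 4 for generic
    cores: this is the nonvanishing of a minor, a polynomial in the cores which
    takes the value 1 when the four cores are matrix units and all others are
    truncated identities ([generic_minor]). As a singular value is positive
    exactly up to the rank ([sigma_gt0]), the largest of the three compared
    values is that of the crossing pairing, and the Four-Index Algorithm returns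
    the true cyclic order of the four labels up to reflection
    ([four_index_crossing]).

    The exceptional set is the union of the zero sets of these minors over the
    finitely many choices of four labels and of fixed indices. It is null
    ([null_zero_sets]): going from a point where F does not vanish to a zero of F
    by replacing one coordinate at a time, some replacement makes F vanish, and
    along that coordinate F is a nonzero univariate polynomial. So the zero set
    is a countable union of compact sets with finite slices in some coordinate
    direction, and such sets have content zero ([content_zero_slices]).

    With correct answers, the list built by the algorithm stays sorted for the
    cyclic order of the ring, in one of its two orientations, fixed by the first
    call. A new label belongs in exactly one gap of the list, and the ternary
    search keeps that gap within its bounds ([search_stepE]). At the end all
    labels are in the list; a permutation which preserves the cyclic order is a
    rotation ([cyclic_perm_rotation]), so the result lies in the class of tau. *)

(** * Singular values and rank *)

Lemma char_poly_similar (K : fieldType) n (P A : 'M[K]_n) :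
  P \in unitmx -> char_poly (invmx P *m A *m P) = char_poly A.
Proof.
move=> uP; rewrite /char_poly /char_poly_mx.
have -> : 'X%:M - map_mx polyC (invmx P *m A *m P) =
   map_mx polyC (invmx P) *m ('X%:M - map_mx polyC A) *m map_mx polyC P.
  rewrite mulmxBr mulmxBl !map_mxM /=; congr (_ - _).
  by rewrite -mulmxA -scalar_mxC mulmxA -map_mxM mulVmx // map_mx1 mul1mx.
by rewrite !det_mulmx mulrAC -det_mulmx -map_mxM mulVmx // map_mx1 det1 mul1r.
Qed.

(** The row space of a diagonal matrix is the direct sum of the coordinate lines
    of its nonzero entries. *)
Lemma mxrank_diag (K : fieldType) n (d : 'rV[K]_n) :
  \rank (diag_mx d) = #|[pred i | d 0 i != 0]|.
Proof.
have rowd i : row i (diag_mx d) = d 0 i *: delta_mx 0 i.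
  apply/rowP => j; rewrite !mxE eqxx /= eq_sym; case: eqVneq => _.
    by rewrite mulr1n mulr1.
  by rewrite mulr0n mulr0.
have -> : \rank (diag_mx d) =
    \rank (\sum_(i | d 0 i != 0) <<delta_mx 0 i : 'rV[K]_n>>)%MS.
  apply/eqmx_rank/andP; split.
    apply/row_subP => i; rewrite rowd.
    have [->|di] := eqVneq (d 0 i) 0; first by rewrite scale0r sub0mx.
    by apply/scalemx_sub/(sumsmx_sup i) => //; rewrite genmxE.
  apply/sumsmx_subP => i di; rewrite genmxE.
  have -> : delta_mx 0 i = (d 0 i)^-1 *: row i (diag_mx d).
    by rewrite rowd scalerA mulVf // scale1r.
  exact/scalemx_sub/row_sub.
have /mxdirectP := @mxdirect_delta K _ [pred i | d 0 i != 0] n id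
  (in2W (fun _ _ => id)).
move=> /= ->; rewrite -sum1_card.
by apply: eq_bigr => i _; rewrite mxrank_gen mxrank_delta.
Qed.

Section Gram.
Variable R : realType.

(** If X M^T M = 0 then (X M^T)(X M^T)^T = 0, whose diagonal entries are sums of
    squares; so M^T M and M^T have the same left kernel. *)
Lemma mxrank_gram k l (M : 'M[R]_(k, l)) : \rank (M^T *m M) = \rank M.
Proof.
apply/eqP; rewrite eqn_leq mxrankS ?submxMl //=.
set X := kermx (M^T *m M).
have XM0 : X *m M^T = 0.
  have E : (X *m M^T) *m (X *m M^T)^T = 0.
    by rewrite trmx_mul trmxK !mulmxA -(mulmxA X) mulmx_ker mul0mx.
  apply/matrixP => i j; rewrite [RHS]mxE.
  move/matrixP: E => /(_ i i); rewrite mxE [RHS]mxE => /eqP.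
  rewrite psumr_eq0; last first.
    by move=> s _; rewrite [_^T _ _]mxE -expr2 sqr_ge0.
  by move=> /allP/(_ j (mem_index_enum j))/=; rewrite [_^T _ _]mxE mulf_eq0 orbb => /eqP.
have /mxrankS : (X <= kermx M^T)%MS by apply/sub_kermxP.
rewrite !mxrank_ker mxrank_tr.
have := rank_leq_col M; have := rank_leq_row (M^T *m M); lia.
Qed.

(** M^T M is unitarily diagonalizable over R[i]. Its eigenvalues are real since
    it is Hermitian, so the factorization of its characteristic polynomial
    descends to R; they are nonnegative since v M^T M v^T is a sum of squares. *)
Lemma char_poly_gram k l (M : 'M[R]_(k, l)) : exists d : 'rV[R]_l,
  char_poly (M^T *m M) = \prod_i ('X - (d 0 i)%:P) /\
  #|[pred i | 0 < d 0 i]| = \rank M.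
Proof.
pose f : {rmorphism R -> R[i]} := real_complex R.
pose G := M^T *m M; pose A := map_mx f G.
have Ah : A \is hermsymmx.
  apply: realsym_hermsym.
    apply/is_hermitianmxP; rewrite expr0 scale1r /A /G map_mxM trmx_mul !map_trmx.
    by rewrite map_mx_id // trmxK.
  by apply/mxOverP => i j; rewrite mxE complex_real.
pose P := spectralmx A; pose D := spectral_diag A.
have uP : P \in unitmx := spectral_unit A.
have AE : A = invmx P *m diag_mx D *m P.
  by apply/orthomx_spectralP/hermitian_normalmx.
have Dr : D \is a mxOver Num.real := hermitian_spectral_diag_real Ah.
pose d : 'rV[R]_l := map_mx (@complex.Re R) D.
have dD : map_mx f d = D.
  by apply/matrixP => i j; rewrite !mxE [f _]RRe_real // (mxOverP Dr).
have cpG : char_poly G = \prod_i ('X - (d 0 i)%:P).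
  apply: (map_poly_inj f); rewrite map_char_poly -/A AE char_poly_similar //.
  rewrite char_poly_trig; last first.
    by apply/is_trig_mxP => i j ij; rewrite mxE -val_eqE ltn_eqF.
  rewrite rmorph_prod; apply: eq_bigr => i _.
  by rewrite [RHS]map_polyXsubC mxE eqxx mulr1n -dD mxE.
exists d; split => //.
have d_ge0 i : 0 <= d 0 i.
  have : eigenvalue G (d 0 i).
    rewrite eigenvalue_root_char cpG -(big_map (d 0) xpredT (fun x => 'X - x%:P)).
    by rewrite root_prod_XsubC map_f // mem_index_enum.
  case/eigenvalueP => v vG v0.
  have /matrixP/(_ 0 0) : (v *m M^T) *m (v *m M^T)^T = d 0 i *: (v *m v^T).
    by rewrite trmx_mul trmxK !mulmxA -(mulmxA v) vG scalemxAl.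
  have nn n (w : 'rV[R]_n) : 0 <= (w *m w^T) 0 0.
    by rewrite mxE sumr_ge0 // => s _; rewrite [_^T _ _]mxE -expr2 sqr_ge0.
  have vv : 0 < (v *m v^T) 0 0.
    rewrite lt_def nn andbT; apply: contra_neq v0.
    rewrite mxE => /eqP; rewrite psumr_eq0; last first.
      by move=> s _; rewrite [_^T _ _]mxE -expr2 sqr_ge0.
    move=> /allP h; apply/rowP => j; have /= := h j (mem_index_enum j).
    by rewrite [_^T _ _]mxE mulf_eq0 orbb [RHS]mxE => /eqP.
  move=> E; have := nn _ (v *m M^T); rewrite E mxE.
  by rewrite pmulr_lge0.
rewrite -mxrank_gram -/G -(mxrank_map f) -/A AE.
rewrite mxrankMfree ?row_free_unit //.
rewrite -mxrank_tr trmx_mul mxrankMfree ?mxrank_tr; last first.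
  by rewrite row_free_unit unitmx_tr unitmx_inv.
rewrite mxrank_diag; apply: eq_card => i; rewrite !inE.
have -> : D 0 i = f (d 0 i) by rewrite -dD [LHS]mxE.
by rewrite fmorph_eq0 lt_def d_ge0 andbT.
Qed.

(** The multiplicity of a root x of the product is the number of factors 'X - x,
    so both lists are rearrangements of each other. *)
Lemma count_roots_with_mult (a : pred R) (s : seq R) :
  count a (roots_with_mult (\prod_(x <- s) ('X - x%:P))) = count a s.
Proof.
set P := \prod_(x <- s) _; have P0 : P != 0 by rewrite monic_neq0 ?monic_prod_XsubC.
have memr : rootsR P =i undup s.
  by move=> x; rewrite -roots_on_rootsR //= mem_undup root_prod_XsubC.
have ur : uniq (rootsR P).
  by apply: (sorted_uniq (@lt_trans _ _) (@lt_irreflexive _ _)); rewrite sorted_roots.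
rewrite /roots_with_mult count_flatten -map_comp map_rev sumn_rev.
have -> : count a s = (\sum_(x <- undup s) a x * count_mem x s)%N.
  rewrite -sum1_count -big_undup_iterop_count big_mkcond /=.
  apply: eq_bigr => x _; rewrite Monoid.iteropE iter_addn_0.
  by case: (a x); rewrite ?mul1n.
rewrite sumnE big_map (perm_big (undup s)) /=; last first.
  by apply: uniq_perm; rewrite ?undup_uniq.
by apply: eq_bigr => x _; rewrite /= count_nseq mu_prod_XsubC.
Qed.

Lemma sorted_roots_with_mult (P : {poly R}) :
  sorted (fun x y => y <= x) (roots_with_mult P).
Proof.
rewrite /roots_with_mult; have := sorted_roots (- cauchy_bound P) (cauchy_bound P) P.
rewrite -/(rootsR P) -(rev_sorted (fun x y => y < x)).
elim: (rev _) => //= x s IH; rewrite (path_sortedE (rev_trans lt_trans)).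
case/andP => /allP hx /IH ih; rewrite sorted_pairwise; last exact: rev_trans le_trans.
rewrite pairwise_cat -!sorted_pairwise; try exact: rev_trans le_trans.
rewrite ih andbT; apply/andP; split.
  apply/allrelP => y z /nseqP[-> _] /flatten_mapP[w ws /nseqP[-> _]].
  exact/ltW/hx.
elim: mup => //= n; case: n => //= n ->; by rewrite lexx.
Qed.

(** The singular values are listed in decreasing order and exactly \rank M of them
    are positive, so the s-th one is positive precisely when s <= \rank M. *)
Lemma sigma_gt0 s k l (M : 'M[R]_(k, l)) :
  (0 < s)%N -> (0 < sigma s M) = (s <= \rank M)%N.
Proof.
move=> s0; have [d [cpE <-]] := char_poly_gram M.
have -> : #|[pred i | 0 < d 0 i]| = count (fun x => 0 < x) (roots_with_mult (char_poly (M^T *m M))).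
  rewrite cpE -(big_map (d 0) xpredT (fun x => 'X - x%:P)) count_roots_with_mult.
  by rewrite count_map -sum1_count -sum1_card.
rewrite /sigma /singular_values.
have := sorted_roots_with_mult (char_poly (M^T *m M)).
move: (roots_with_mult _) => t; case: s s0 => //= s _.
elim: t s => [|x t IH] s /=; first by rewrite nth_nil ltxx.
move=> tx; have ts := path_sorted tx.
move: tx; rewrite (path_sortedE (rev_trans le_trans)) => /andP[/allP ax _].
case: s => [|s] /=.
  rewrite sqrtr_gt0; case: ltP => //= x0; rewrite add0n.
  apply/esym/negbTE; rewrite -leqNgt leqn0 -leqn0 leqNgt -has_count.
  by apply/hasPn => y /ax yx; rewrite -leNgt (le_trans yx).
rewrite IH //; case: ltP => x0 /=; first by rewrite ltnS.
rewrite add0n; suff -> : count (fun y => 0 < y) t = 0%N by [].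
apply/eqP; rewrite -leqn0 leqNgt -has_count.
by apply/hasPn => y /ax yx; rewrite -leNgt (le_trans yx).
Qed.

Lemma sigma_ge0 s k l (M : 'M[R]_(k, l)) : 0 <= sigma s M.
Proof.
rewrite /sigma /singular_values; by elim: roots_with_mult s.-1 => [|x t IH] [|j] //=.
Qed.

End Gram.

(** * Null sets of polynomial functions *)

Section Negligible.
Local Open Scope classical_set_scope.
Variables (R : realType) (I : finType).
Implicit Types (A : set (I -> R)) (x u : I -> R) (F : (I -> R) -> R).

Definition finite_cover A (v : R) := exists (J : finType) (a b : J -> I -> R),
  [/\ forall j k, a j k <= b j k,
      A `<=` \bigcup_(j in setT) box (a j) (b j) &
      \sum_j box_volume (a j) (b j) <= v].

Definition content_zero A := forall e, 0 < e -> finite_cover A e.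

Definition update x i t : I -> R := fun k => if k == i then t else x k.

Lemma box_volume_ge0 (a b : I -> R) : (forall k, a k <= b k) -> 0 <= box_volume a b.
Proof. by move=> ab; apply: prodr_ge0 => k _; rewrite subr_ge0. Qed.

Lemma lebesgue_outer_measure_ge0 A : (0 <= lebesgue_outer_measure A)%E.
Proof.
apply: le_ereal_inf_tmp => _ [a [b [ab _ ->]]]; apply: nneseries_ge0 => k _ _.
by rewrite lee_fin box_volume_ge0.
Qed.

Lemma nested_interval (v h : nat -> R) :
  (forall n, `|v n.+1 - v n| <= h n - h n.+1) -> (forall n, 0 <= h n) ->
  exists l, forall n, `|l - v n| <= h n.
Proof.
move=> vh h0.
have mono k n : v n - h n <= v (n + k)%N - h (n + k)%N /\
                v (n + k)%N + h (n + k)%N <= v n + h n.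
  elim: k => [|k [IH1 IH2]]; first by rewrite addn0.
  rewrite addnS; have := vh (n + k)%N; rewrite ler_norml => /andP[? ?]; split; lra.
have le m n : v m - h m <= v n + h n.
  case: (leqP m n) => [mn|/ltnW nm].
    have [+ _] := mono (n - m)%N m; rewrite subnKC // => ?; have := h0 n; lra.
  have [_] := mono (m - n)%N n; rewrite subnKC // => ?; have := h0 m; lra.
pose S := range (fun n => v n - h n).
have S0 : S !=set0 by exists (v 0 - h 0); exists 0%N.
have Sub n : ubound S (v n + h n) by move=> _ [m _ <-]; exact: le.
exists (sup S) => n; rewrite ler_norml; apply/andP; split.
  have : v n - h n <= sup S.
    by apply: ub_le_sup; [exists (v 0 + h 0)|exists n].
  lra.
have : sup S <= v n + h n by apply: ge_sup.
lra.
Qed.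

Lemma bolzano_weierstrass (M : R) (v : nat -> R) : (forall n, `|v n| <= M) ->
  exists t, forall (d : R) N, 0 < d -> exists2 n, (N <= n)%N & `|v n - t| < d.
Proof.
move=> vM; have := @segment_compact R (- M) M.
move=> /(_ (v @ \oo) _)[].
  by exists 0%N => // n _ /=; rewrite in_itv /= -ler_norml.
move=> t [_ cl]; exists t => d N d0.
have tail : (v @ \oo) (v @` [set n | (N <= n)%N]).
  by exists N => // n Nn; exists n.
have [_ [[n /= Nn <-] tn]] := cl _ _ tail (nbhsx_ballx (t : R) d d0).
by exists n => //; rewrite distrC.
Qed.

(** A compact set whose slices in direction i are all finite has content zero.
    Near a base point the set stays close to the finitely many points of one
    slice, by compactness of the direction-i interval, so above a small enough
    cube of the other coordinates it is covered by thin slabs. If the whole set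
    had no cheap cover, repeated halving of the other coordinates would produce a
    nested sequence of cubes without one, contradicting this at its limit. *)
Section FiniteSlices.
Variables (A : set (I -> R)) (i : I) (M : R).
Hypothesis M_gt0 : 0 < M.
Hypothesis A_bounded : forall x, A x -> forall k, `|x k| <= M.
Hypothesis A_closed : forall x, ~ A x ->
  exists2 d : R, 0 < d & forall y, (forall k, `|y k - x k| < d) -> ~ A y.
Hypothesis A_slice : forall x, exists s : seq R, forall t, A (update x i t) -> t \in s.

Let cyl (c : I -> R) (h : R) := [set x | A x /\ forall j, j != i -> `|x j - c j| <= h].
Let D := #|I|.-1.
Variables (e : R) (e_gt0 : 0 < e).
(** This normalization is preserved when the 2 ^ D halves of a cube are put back
    together. *)
Let good c h := finite_cover (cyl c h) (e * h ^+ D).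
Let S := {ffun {j : I | j != i} -> bool}.
(** The center of one of the 2 ^ D halved cubes, chosen by signs; coordinate i is
    not cut. *)
Let shift (c : I -> R) h (s : S) : I -> R := fun j =>
  if insub j is Some jj then c j + (if s jj then h / 2 else - (h / 2)) else c j.

Let card_rest : #|{: {j : I | j != i}}| = D.
Proof. by rewrite card_sig /D -(cardC1 i); apply: eq_card => j; rewrite !inE. Qed.

Lemma good_halves c h : (forall s, good (shift c h s) (h / 2)) -> good c h.
Proof.
move=> goodP.
have /choice[f abP] : forall s : S, exists z : {J : finType & (J -> I -> R) * (J -> I -> R)}%type,
  [/\ forall j k, (tagged z).1 j k <= (tagged z).2 j k,
      cyl (shift c h s) (h / 2) `<=`
        \bigcup_(j in setT) box ((tagged z).1 j) ((tagged z).2 j) &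
      \sum_j box_volume ((tagged z).1 j) ((tagged z).2 j) <= e * (h / 2) ^+ D].
  by move=> s; have [J [a [b abP]]] := goodP s; exists (Tagged (fun J : finType => (J -> I -> R) * (J -> I -> R))%type (a, b)).
pose J s := tag (f s); pose a s := (tagged (f s)).1; pose b s := (tagged (f s)).2.
exists {s : S & J s}, (fun z => a _ (tagged z)), (fun z => b _ (tagged z)).
split.
- by case=> s j; have [+ _ _] := abP s; exact.
- move=> x [Ax xc].
  pose s : S := [ffun jj => c (val jj) <= x (val jj)].
  have [_ + _] := abP s => /(_ x)[].
    split=> // j ji; rewrite /shift; case: insubP => [jj _ vj|]; last by rewrite ji.
    rewrite ffunE vj; have := xc j ji; rewrite !ler_norml.
    by case: (leP (c j) (x j)) => ? /andP[? ?]; apply/andP; split; lra.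
  by move=> j _ xj; exists (Tagged J j).
rewrite -(sig_big_dep (fun _ => true) (fun _ _ => true)
  (fun s j => box_volume (a s j) (b s j))) /=.
apply: (@le_trans _ _ (\sum_(s : S) e * (h / 2) ^+ D)).
  by apply: ler_sum => s _; have [_ _] := abP s.
rewrite sumr_const card_ffun card_bool card_rest -[leLHS]mulr_natr natrX exprMn exprVn.
by rewrite -mulrA mulrVK ?unitfE ?expf_neq0.
Qed.

Lemma good_start : good (fun=> 0) M.
Proof.
apply: contrapT => bad0.
pose h n := M / 2 ^+ n.
have h_gt0 n : 0 < h n by rewrite divr_gt0 ?exprn_gt0.
have hS n : h n.+1 = h n / 2 by rewrite /h exprSr invfM mulrA.
(* Choose, from a cube without a cheap cover, a halved one of the same kind. *)
have nxt : forall nc : nat * (I -> R), exists c', ~ good nc.2 (h nc.1) ->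
    ~ good c' (h nc.1.+1) /\ forall j, `|c' j - nc.2 j| <= h nc.1 / 2.
  case=> n c /=; case: (pselect (good c (h n))) => [g|ng]; first by exists c.
  have [s bs] : exists s, ~ good (shift c (h n) s) (h n / 2).
    by apply/existsNP => gs; apply/ng/good_halves.
  exists (shift c (h n) s) => _; rewrite hS; split=> // j; rewrite /shift.
  have := h_gt0 n; case: insubP => [jj _ _|_]; last by rewrite subrr normr0; lra.
  by rewrite addrC addKr; case: (s jj); rewrite ?normrN; move=> ?; rewrite ger0_norm; lra.
have {nxt}[f fP] := choice nxt.
pose u := fix u n := if n is n'.+1 then f (n', u n') else (fun=> 0) : I -> R.
have ub n : ~ good (u n) (h n).
  elim: n => [|n IH] /=; first by rewrite /h expr0 divr1.
  by have [] := fP (n, u n) IH.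
have ud n j : `|u n.+1 j - u n j| <= h n - h n.+1.
  by have [_ /(_ j)] := fP (n, u n) (ub n); rewrite hS /=; lra.
have {ud} /choice[l lP] : forall j, exists l, forall n, `|l - u n j| <= h n.
  by move=> j; apply: nested_interval => n; [exact: ud|exact: ltW].
have [s sP] := A_slice l.
(* With this width the slabs around s fill at most the allowed volume. *)
pose eta := e / (2 ^+ #|I| * (size s).+1%:R).
have eta_gt0 : 0 < eta by rewrite divr_gt0 // mulr_gt0 ?exprn_gt0 ?ltr0n.
have hlim (d : R) : 0 < d -> exists N, forall n, (N <= n)%N -> h n < d.
  move=> d0; exists (Num.bound (M / d)) => n Nn.
  rewrite /h ltr_pdivrMr ?exprn_gt0 // mulrC -ltr_pdivrMr //.
  have : M / d < (Num.bound (M / d))%:R by rewrite archi_boundP // divr_ge0 ?ltW.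
  move/lt_trans; apply; rewrite (@le_lt_trans _ _ n%:R) ?ler_nat //.
  by rewrite -natrX ltr_nat ltn_expl.
have [n nP] : exists n, forall x, cyl (u n) (h n) x ->
    exists2 t, t \in s & `|x i - t| <= eta.
  apply: contrapT => /forallNP no.
  have /choice[x xP] : forall n, exists x, cyl (u n) (h n) x /\
      forall t, t \in s -> eta < `|x i - t|.
    move=> n; have /existsNP[x /not_implyP[cx nx]] := no n.
    exists x; split=> // t ts; rewrite ltNge; apply/negP => le.
    by apply: nx; exists t.
  have [t tP] : exists t, forall (d : R) N, 0 < d ->
      exists2 n, (N <= n)%N & `|x n i - t| < d.
    by apply: (@bolzano_weierstrass M) => n; have [[Ax _] _] := xP n; exact: A_bounded.
  have [/sP ts|nA] := pselect (A (update l i t)).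
    have [n _] := tP eta 0%N eta_gt0.
    by have [_ /(_ _ ts)] := xP n; move=> /lt_trans h1 /h1; rewrite ltxx.
  have [d d0 dP] := A_closed nA.
  have [N NP] := hlim (d / 2) ltac:(lra).
  have [n Nn xt] := tP d N d0.
  have [[Ax xu] _] := xP n; apply: (dP (x n)) Ax => k; rewrite /update.
  case: eqVneq => [->//|ki].
  have := xu k ki; have := lP k n; have := NP n Nn; rewrite distrC => ? ? ?.
  by apply: le_lt_trans (ler_distD (u n k) _ _) _; lra.
apply: (ub n).
exists 'I_(size s),
  (fun (t : 'I_(size s)) k => if k == i then s`_t - eta else u n k - h n),
  (fun (t : 'I_(size s)) k => if k == i then s`_t + eta else u n k + h n); split.
- move=> t k; case: eqP => _; first by have := eta_gt0; lra.
  by have := h_gt0 n; lra.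
- move=> x cx; have [t ts xt] := nP x cx; have [_ xu] := cx.
  have st : (index t s < size s)%N by rewrite index_mem.
  exists (Ordinal st) => // k; case: eqVneq => [->|ki] /=.
    by rewrite nth_index //; move: xt; rewrite ler_norml => /andP[? ?]; apply/andP; split; lra.
  by have := xu k ki; rewrite ler_norml => /andP[? ?]; apply/andP; split; lra.
apply: (@le_trans _ _ (\sum_(t < size s) (eta *+ 2) * (h n *+ 2) ^+ D)).
  apply: ler_sum => t _; rewrite /box_volume (bigD1 i) //= eqxx.
  have -> : s`_t + eta - (s`_t - eta) = eta *+ 2 by rewrite mulr2n; ring.
  apply: ler_wpM2l; first by rewrite mulrn_wge0 // ltW.
  rewrite (eq_bigr (fun=> h n *+ 2)); last first.
    by move=> k /negPf ->; rewrite mulr2n; ring.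
  by rewrite prodr_const cardC1.
have I0 : (0 < #|I|)%N by apply/card_gt0P; exists i.
rewrite sumr_const card_ord -[leLHS]mulr_natr -(mulr_natr eta) -(mulr_natr (h n)) exprMn /eta /D.
rewrite -[in 2 ^+ #|I|](prednK I0) exprS.
set p := h n ^+ _; set q := 2 ^+ _; have q0 : q != 0 by rewrite expf_neq0.
have := ltr0Sn R (size s); have : ((size s)%:R : R) <= (size s).+1%:R.
  by rewrite ler_nat.
move: (size s)%:R (size s).+1%:R => y z yz z0.
have -> : e / (2 * q * z) * 2 * (p * q) * y = (e * p) * (y / z).
  by field; rewrite q0 gt_eqF.
apply: ler_piMr; first by rewrite mulr_ge0 ?exprn_ge0 ?ltW.
by rewrite ler_pdivrMr // mul1r.
Qed.

Lemma content_zero_aux : finite_cover A (e * M ^+ D).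
Proof.
have [J [a [b [ab Aab vol]]]] := good_start.
exists J, a, b; split=> // x Ax; apply: Aab; split=> // j _.
by rewrite subr0 A_bounded.
Qed.

End FiniteSlices.

Lemma content_zero_slices A i (M : R) : 0 < M ->
  (forall x, A x -> forall k, `|x k| <= M) ->
  (forall x, ~ A x ->
    exists2 d : R, 0 < d & forall y, (forall k, `|y k - x k| < d) -> ~ A y) ->
  (forall x, exists s : seq R, forall t, A (update x i t) -> t \in s) ->
  content_zero A.
Proof.
move=> M0 Ab Ac As e e0.
have := @content_zero_aux A i M M0 Ab Ac As (e / M ^+ #|I|.-1).
rewrite divfK ?expf_neq0 ?gt_eqF //; apply.
by rewrite divr_gt0 // exprn_gt0.
Qed.

Lemma content_zero0 : content_zero set0.
Proof.
move=> e e0; exists 'I_0, (fun _ _ => 0), (fun _ _ => 0); split=> //.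
by rewrite big_ord0 ltW.
Qed.

Lemma box_volume_degenerate (a : I -> R) : (0 < #|I|)%N -> box_volume a a = 0.
Proof.
by case/card_gt0P => i _; rewrite /box_volume (bigD1 i) //= subrr mul0r.
Qed.

(** Padding with degenerate boxes, whose volume vanishes as soon as there is at
    least one coordinate. *)
Lemma sequence_of_finite_cover A v : (0 < #|I|)%N -> finite_cover A v ->
  exists ab : nat -> (I -> R) * (I -> R),
  [/\ forall j k, (ab j).1 k <= (ab j).2 k,
      A `<=` \bigcup_j box (ab j).1 (ab j).2 &
      forall K, \sum_(j < K) box_volume (ab j).1 (ab j).2 <= v].
Proof.
move=> I0 [J [a [b [ab Aab vol]]]].
pose c j := if insub j : option 'I_#|J| is Some t
            then (a (enum_val t), b (enum_val t)) else (fun=> 0, fun=> 0).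
have c_le j k : (c j).1 k <= (c j).2 k by rewrite /c; case: insub => [t|] /=.
exists c; split => //.
  move=> x /Aab[j _ xj]; exists (enum_rank j : nat) => //.
  by rewrite /c valK /= enum_rankK.
move=> K; apply: le_trans vol; rewrite -(big_mkord xpredT (fun j => box_volume (c j).1 (c j).2)).
have c_ge0 j : 0 <= box_volume (c j).1 (c j).2 by exact: box_volume_ge0.
apply: (@le_trans _ _ (\sum_(0 <= j < #|J| + K) box_volume (c j).1 (c j).2)).
  by rewrite addnC [leRHS](big_cat_nat (n := K)) //= ?leq_addr // lerDl sumr_ge0.
rewrite (big_cat_nat (n := #|J|)) //= ?leq_addr // big_mkord.
rewrite [X in _ + X]big_nat [X in _ + X]big1 ?addr0 => [|j /andP[Jj _]]; last first.
  by rewrite /c insubF ?box_volume_degenerate // ltnNge Jj.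
by rewrite [leRHS]big_enum_val; apply: ler_sum => t _; rewrite /c valK.
Qed.

(** Covers of the A k with total volumes e / 2, e / 4, ... are merged along a
    bijection between nat and nat * nat. *)
Lemma null_bigcup (A : nat -> set (I -> R)) : (0 < #|I|)%N ->
  (forall k, content_zero (A k)) ->
  lebesgue_outer_measure (\bigcup_k A k) = 0%E.
Proof.
move=> I0 A0; apply/eqP; rewrite eq_le; apply/andP; split; last exact: lebesgue_outer_measure_ge0.
apply/lee_addgt0Pr => e e0; rewrite add0e.
have /choice[f fP] : forall k, exists ab : nat -> (I -> R) * (I -> R),
  [/\ forall j i, (ab j).1 i <= (ab j).2 i,
      A k `<=` \bigcup_j box (ab j).1 (ab j).2 &
      forall K, \sum_(j < K) box_volume (ab j).1 (ab j).2 <= e / 2 ^+ k.+1].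
  by move=> k; apply/sequence_of_finite_cover/A0; rewrite // divr_gt0 ?exprn_gt0.
have [g [_ ginj gsurj]] : exists g, set_bij [set: nat] [set: nat * nat] g.
  by apply/card_set_bijP; rewrite card_eq_sym card_nat2.
pose c n := f (g n).1 (g n).2.
have c_le n i : (c n).1 i <= (c n).2 i by have [+ _ _] := fP (g n).1; exact.
apply: (@le_trans _ _ (\sum_(0 <= n <oo) (box_volume (c n).1 (c n).2)%:E)%E).
  apply: ereal_inf_lbound; exists (fun n => (c n).1), (fun n => (c n).2); split=> //.
  move=> x [k _]; have [_ + _] := fP k => /[apply] -[j _ xj].
  by have [n _ gn] := gsurj (k, j) Logic.I; exists n => //; rewrite /c gn.
apply: lime_le.
  by apply: is_cvg_nneseries => n _ _; rewrite lee_fin box_volume_ge0.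
apply: nearW => N; rewrite /= sumEFin lee_fin big_mkord.
pose v (z : nat * nat) := box_volume (f z.1 z.2).1 (f z.1 z.2).2.
have v_ge0 z : 0 <= v z by apply: box_volume_ge0; have [+ _ _] := fP z.1; exact.
have [K KP] : exists K, forall n, (n < N)%N -> ((g n).1 < K)%N /\ ((g n).2 < K)%N.
  elim: (N) => [|n [K KP]]; first by exists 0%N.
  exists (K + (g n).1.+1 + (g n).2.+1)%N => i; rewrite ltnS leq_eqVlt.
  case/predU1P => [->|/KP[]]; split; lia.
pose h (n : 'I_N) : 'I_K * 'I_K :=
  (Ordinal (KP n (ltn_ord n)).1, Ordinal (KP n (ltn_ord n)).2).
have hinj : injective h.
  move=> n n' [h1 h2]; apply/val_inj/ginj; rewrite ?inE //.
  by rewrite [g n]surjective_pairing [g n']surjective_pairing h1 h2.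
pose w (z : 'I_K * 'I_K) := v (z.1 : nat, z.2 : nat).
apply: (@le_trans _ _ (\sum_(z in h @: 'I_N) w z)%R).
  rewrite big_imset /=; last by move=> ? ? _ _; exact: hinj.
  by rewrite [leRHS](eq_bigl xpredT).
apply: (@le_trans _ _ (\sum_z w z)%R).
  rewrite big_mkcond /=; apply: ler_sum => z _; case: ifP => // _; exact: v_ge0.
rewrite -(pair_bigA _ (fun i j => w (i, j))) /=.
apply: (@le_trans _ _ (\sum_(k < K) e / 2 ^+ k.+1)).
  by apply: ler_sum => k _; have [_ _] := fP k; exact.
have -> : \sum_(k < K) e / 2 ^+ k.+1 = e - e / 2 ^+ K.
  elim: (K) => [|k IH]; first by rewrite big_ord0 expr0 divr1 subrr.
  rewrite big_ord_recr /= IH exprS invfM; field.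
  by rewrite expf_neq0.
by rewrite lerBlDr lerDl divr_ge0 ?exprn_ge0 ?ltW.
Qed.

Lemma null_bigcup_count (T : countType) (A : T -> set (I -> R)) : (0 < #|I|)%N ->
  (forall t, content_zero (A t)) ->
  lebesgue_outer_measure (\bigcup_t A t) = 0%E.
Proof.
move=> I0 A0; pose B k := if unpickle k is Some t then A t else set0.
have -> : \bigcup_t A t = \bigcup_k B k.
  apply/seteqP; split => x [t _ xt]; first by exists (pickle t); rewrite // /B pickleK.
  by move: xt; rewrite /B; case: unpickle => // s xs; exists s.
apply: null_bigcup => // k; rewrite /B; by case: unpickle => [t|]; [exact: A0|exact: content_zero0].
Qed.

(** A syntactic closure: continuity, restriction to a coordinate line and partial
    substitution each follow by one induction. *)
Inductive polyfun : ((I -> R) -> R) -> Prop :=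
| polyfun_const c : polyfun (fun=> c)
| polyfun_coord i : polyfun (fun x => x i)
| polyfunD F G : polyfun F -> polyfun G -> polyfun (fun x => F x + G x)
| polyfunM F G : polyfun F -> polyfun G -> polyfun (fun x => F x * G x).

Lemma polyfun_sum (J : Type) (s : seq J) (P : pred J) (F : J -> (I -> R) -> R) :
  (forall j, polyfun (F j)) -> polyfun (fun x => \sum_(j <- s | P j) F j x).
Proof.
move=> FP; elim: s => [|j s IH].
  rewrite (_ : (fun _ => _) = fun=> 0); first exact: polyfun_const.
  by apply/funext => x; rewrite big_nil.
rewrite (_ : (fun _ => _) = fun x => (if P j then F j x else 0) + \sum_(j <- s | P j) F j x).
  apply: polyfunD => //; case: (P j) => //; exact: polyfun_const.
by apply/funext => x; rewrite big_cons; case: ifP => //; rewrite add0r.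
Qed.

Lemma polyfun_prod (J : Type) (s : seq J) (P : pred J) (F : J -> (I -> R) -> R) :
  (forall j, polyfun (F j)) -> polyfun (fun x => \prod_(j <- s | P j) F j x).
Proof.
move=> FP; elim: s => [|j s IH].
  rewrite (_ : (fun _ => _) = fun=> 1); first exact: polyfun_const.
  by apply/funext => x; rewrite big_nil.
rewrite (_ : (fun _ => _) = fun x => (if P j then F j x else 1) * \prod_(j <- s | P j) F j x).
  apply: polyfunM => //; case: (P j) => //; exact: polyfun_const.
by apply/funext => x; rewrite big_cons; case: ifP => //; rewrite mul1r.
Qed.

Lemma polyfun_det k (M : (I -> R) -> 'M[R]_k) :
  (forall i j, polyfun (fun x => M x i j)) -> polyfun (fun x => \det (M x)).
Proof.
move=> MP; apply: polyfun_sum => s; apply: polyfunM; first exact: polyfun_const.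
exact: polyfun_prod.
Qed.

Lemma polyfun_mulmx k l p (M : (I -> R) -> 'M[R]_(k, l)) (N : (I -> R) -> 'M[R]_(l, p)) :
  (forall i j, polyfun (fun x => M x i j)) ->
  (forall i j, polyfun (fun x => N x i j)) ->
  forall i j, polyfun (fun x => (M x *m N x) i j).
Proof.
move=> MP NP i j; rewrite (_ : (fun _ => _) = fun x => \sum_s M x i s * N x s j).
  by apply: polyfun_sum => s; exact: polyfunM.
by apply/funext => x; rewrite mxE.
Qed.

Lemma polyfun_continuous F : polyfun F -> forall x (e : R), 0 < e ->
  exists2 d : R, 0 < d & forall y, (forall k, `|y k - x k| < d) -> `|F y - F x| < e.
Proof.
elim => [c|i|G H _ IG _ IH|G H _ IG _ IH] x e e0.
- by exists 1 => // y _; rewrite subrr normr0.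
- by exists e.
- have [d d0 dP] := IG x (e / 2) ltac:(lra).
  have [d' d'0 d'P] := IH x (e / 2) ltac:(lra).
  exists (Num.min d d'); first by rewrite lt_min d0.
  move=> y yx.
  have /all_and2[/dP gx /d'P hx] : forall k, `|y k - x k| < d /\ `|y k - x k| < d'.
    by move=> k; have := yx k; rewrite lt_min => /andP.
  by rewrite opprD addrACA; apply: le_lt_trans (ler_normD _ _) _; lra.
pose B := `|G x| + `|H x| + 1.
have B0 : 0 < B by rewrite /B; have := normr_ge0 (G x); have := normr_ge0 (H x); lra.
pose e' := Num.min 1 (e / (2 * B)).
have e'0 : 0 < e' by rewrite lt_min ltr01 divr_gt0 // mulr_gt0.
have [d d0 dP] := IG x e' e'0.
have [d' d'0 d'P] := IH x e' e'0.
exists (Num.min d d'); first by rewrite lt_min d0.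
move=> y yx.
have /all_and2[/dP gx /d'P hx] : forall k, `|y k - x k| < d /\ `|y k - x k| < d'.
  by move=> k; have := yx k; rewrite lt_min => /andP.
have -> : G y * H y - G x * H x =
  (G y - G x) * (H y - H x) + ((G y - G x) * H x + G x * (H y - H x)) by ring.
have e'1 : e' <= 1 by rewrite /e' ge_min lexx.
have e'B : e' * B * 2 <= e.
  by rewrite -mulrA -ler_pdivlMr ?mulr_gt0 // (mulrC B) /e' ge_min lexx orbT.
apply: le_lt_trans (ler_normD _ _) _; rewrite normrM.
have := ler_normD ((G y - G x) * H x) (G x * (H y - H x)).
rewrite !normrM; move: hx gx e'B; rewrite /B.
have := normr_ge0 (G x); have := normr_ge0 (H x).
have := normr_ge0 (G y - G x); have := normr_ge0 (H y - H x).
move: `|G y - G x| `|H y - H x| `|G x| `|H x| `|_ + _| => g h a b z.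
move=> h0 g0 b0 a0 he ge eB zle.
have : g * h <= e' by rewrite -[e']mul1r ler_pM //; lra.
have : g * b <= e' * b by rewrite ler_wpM2r // ltW.
have : a * h <= e' * a by rewrite mulrC ler_wpM2r // ltW.
nra.
Qed.

Lemma polyfun_line F : polyfun F -> forall x i,
  exists p : {poly R}, forall t, F (update x i t) = p.[t].
Proof.
elim => [c|j|G H _ IG _ IH|G H _ IG _ IH] x i.
- by exists c%:P => t; rewrite hornerC.
- rewrite /update; case: (j == i); first by exists 'X => t; rewrite hornerX.
  by exists (x j)%:P => t; rewrite hornerC.
- have [p pP] := IG x i; have [r rP] := IH x i.
  by exists (p + r) => t; rewrite hornerD pP rP.
have [p pP] := IG x i; have [r rP] := IH x i.
by exists (p * r) => t; rewrite hornerM pP rP.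
Qed.

Lemma polyfun_subst F (P : pred I) u : polyfun F ->
  polyfun (fun x => F (fun k => if P k then x k else u k)).
Proof.
elim => [c|j|G H _ IG _ IH|G H _ IG _ IH].
- exact: polyfun_const.
- case: (P j); [exact: polyfun_coord|exact: polyfun_const].
- exact: (polyfunD IG IH).
exact: (polyfunM IG IH).
Qed.

(** A path from u to x changing one coordinate at each step. *)
Let mix u j x : I -> R := fun k => if (index k (enum I) < j)%N then x k else u k.

Lemma mix0 u x : mix u 0 x = u.
Proof. by apply/funext. Qed.

Lemma mix_all u x : mix u #|I| x = x.
Proof. by apply/funext => k; rewrite /mix cardE index_mem mem_enum. Qed.

Lemma mix_update u x (i : I) t :
  mix u (index i (enum I)).+1 (update x i t) =
  update (mix u (index i (enum I)) x) i t.
Proof.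
apply/funext => k; rewrite /mix /update ltnS leq_eqVlt.
have [->|ki] := eqVneq k i; first by rewrite eqxx.
suff /negPf -> : index k (enum I) != index i (enum I) by [].
apply: contra_neq ki => ki; rewrite -(nth_index i (mem_enum I k)) ki.
by rewrite nth_index ?mem_enum.
Qed.

(** The zeros of F at which coordinate z.1 is the one whose replacement makes F
    vanish, cut down by z.2 to a compact set on which the value before the
    replacement stays away from 0. *)
Let stratum F u (z : I * nat) : set (I -> R) := [set x |
  [/\ F (mix u (index z.1 (enum I)).+1 x) = 0,
      z.2.+1%:R^-1 <= `|F (mix u (index z.1 (enum I)) x)| &
      forall k, `|x k| <= z.2.+1%:R]].

(** The slices in direction i of a stratum lie in the zero set of a univariate
    polynomial whose value at u i is nonzero, hence are finite. *)
Lemma content_zero_stratum F u z : polyfun F -> content_zero (stratum F u z).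
Proof.
move=> Fp; case: z => i M; pose j := index i (enum I).
have Gp : polyfun (fun x => F (mix u j x)) by exact: polyfun_subst.
have Hp : polyfun (fun x => F (mix u j.+1 x)) by exact: polyfun_subst.
apply: (@content_zero_slices _ i M.+1%:R).
- by rewrite ltr0n.
- by move=> x [].
- move=> x /= nx.
  have [|H0] := pselect (F (mix u j.+1 x) != 0).
    rewrite -normr_gt0 => H0; have [d d0 dP] := polyfun_continuous Hp x H0.
    exists d => // y /dP + [Hy _ _]; rewrite Hy sub0r normrN; by rewrite ltxx.
  have [|G0] := pselect (`|F (mix u j x)| < M.+1%:R^-1).
    rewrite -subr_gt0 => H1; have [d d0 dP] := polyfun_continuous Gp x H1.
    exists d => // y /dP yx [_ /= My _].
    have := lerB_dist (F (mix u j y)) (F (mix u j x)); move: yx My; rewrite -/j.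
    move: (F (mix u j y)) (F (mix u j x)) (_^-1) => a b c ab ca; lra.
  have [k xk] : exists k, M.+1%:R < `|x k|.
    apply: contrapT => /forallNP nk; apply: nx; split=> /=.
    - by apply/eqP; case: eqP H0.
    - by rewrite leNgt; apply/negP.
    - by move=> k; rewrite leNgt; apply/negP.
  exists (`|x k| - M.+1%:R); first by rewrite subr_gt0.
  move=> y /(_ k) yx [_ _ /(_ k) /= yk].
  have := lerB_dist (x k) (y k); rewrite distrC; lra.
move=> x; have [p pP] := polyfun_line Hp x i.
exists (rootsR p) => t [/= Ht Gt _].
have p0 : p != 0.
  apply: contraTneq Gt => p0; rewrite -ltNge.
  have -> : mix u j (update x i t) = mix u j.+1 (update x i (u i)).
    rewrite mix_update; apply/funext => k; rewrite /mix /update.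
    by case: eqVneq => [->|//]; rewrite ltnn.
  by rewrite pP p0 horner0 normr0 invr_gt0 ltr0n.
by rewrite -roots_on_rootsR //= /root -pP Ht.
Qed.

(** Replacing the coordinates of u by those of x one at a time leads from
    F u != 0 to F x = 0, so some step destroys nonvanishing. *)
Lemma zero_set_strata F u : F u != 0 ->
  [set x | F x = 0] `<=` \bigcup_z stratum F u z.
Proof.
move=> Fu x /= Fx.
have [j jI [Fj FjS]] : exists2 j, (j < #|I|)%N &
    F (mix u j x) != 0 /\ F (mix u j.+1 x) = 0.
  have: exists n, F (mix u n x) == 0 by exists #|I|; rewrite mix_all Fx.
  case/ex_minnP => -[|j]; first by rewrite mix0 (negPf Fu).
  move=> /eqP Fj jmin; exists j; first by apply: jmin; rewrite mix_all Fx.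
  by split=> //; apply/negP => /jmin; rewrite ltnn.
rewrite cardE in jI; have x0 : I by case: (enum I) jI.
pose i := nth x0 (enum I) j.
have iE : index i (enum I) = j by rewrite index_uniq ?enum_uniq.
pose B := \sum_k `|x k|.
pose M := Num.bound (Num.max B `|F (mix u j x)|^-1).
have /andP[MB MF] : (B < M%:R) && (`|F (mix u j x)|^-1 < M%:R).
  rewrite -gt_max archi_boundP // le_max sumr_ge0 //.
exists (i, M) => //; split=> /=; rewrite ?iE //.
  rewrite -[leRHS]invrK lef_pV2 ?posrE ?invr_gt0 ?normr_gt0 ?ltr0n //.
  by rewrite (le_trans (ltW MF)) // ler_nat.
move=> k; apply: (@le_trans _ _ M%:R); last by rewrite ler_nat.
apply: ltW; apply: le_lt_trans MB; rewrite /B (bigD1 k) //= lerDl.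
exact: sumr_ge0.
Qed.

Lemma null_zero_sets (T : countType) (F : T -> (I -> R) -> R) :
  (0 < #|I|)%N -> (forall t, polyfun (F t)) ->
  (forall t, exists u, F t u != 0) ->
  lebesgue_outer_measure (\bigcup_t [set x | F t x = 0]) = 0%E.
Proof.
move=> I0 Fp /choice[u uF].
pose A (z : T * (I * nat)) := stratum (F z.1) (u z.1) z.2.
have null : lebesgue_outer_measure (\bigcup_z A z) = 0%E.
  by apply: null_bigcup_count => // -[t z]; exact: content_zero_stratum.
apply/eqP; rewrite eq_le; apply/andP; split; last exact: lebesgue_outer_measure_ge0.
rewrite -null; apply: le_ereal_inf => _ [a [b [ab cov ->]]].
exists a, b; split=> // x [t _ Fx]; apply: cov.
by have [z _ xz] := zero_set_strata (uF t) Fx; exists (t, z).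
Qed.

End Negligible.

(** * Cyclic order of positions on a ring *)

(** Travelling upwards from a, and back to 0 at the end, one meets b before c. *)
Definition cyc (a b c : nat) : bool :=
  [|| (a < b < c)%N, (b < c < a)%N | (c < a < b)%N].

(** The chords a b and c d of the ring cross. *)
Definition crossing (a b c d : nat) : bool := cyc a c b != cyc a d b.

Lemma crossing_base e a b c : e != a -> e != b -> e != c ->
  crossing e a b c = (cyc a e b != cyc a e c).
Proof. rewrite /crossing /cyc; lia. Qed.

Lemma cyc_flip x e a : e != a -> e != x -> x != a -> cyc x e a = ~~ cyc a e x.
Proof. rewrite /cyc; lia. Qed.

(** The position of x counted from the base point e on a ring of N places. *)
Definition offset (N e x : nat) : nat := if (e <= x)%N then (x - e)%N else (x + N - e)%N.

(** Rotation invariance; it lets a ring be cut open at a convenient point. *)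
Lemma cyc_offset N e x y z : (e < N)%N -> (x < N)%N -> (y < N)%N -> (z < N)%N ->
  cyc (offset N e x) (offset N e y) (offset N e z) = cyc x y z.
Proof.
by rewrite /cyc /offset => ? ? ? ?; case: (leqP e x); case: (leqP e y);
  case: (leqP e z); lia.
Qed.

Lemma offset_base N e : offset N e e = 0%N.
Proof. by rewrite /offset leqnn subnn. Qed.

Lemma offset_inj N e x y : (e < N)%N -> (x < N)%N -> (y < N)%N ->
  offset N e x = offset N e y -> x = y.
Proof. by rewrite /offset; case: (leqP e x); case: (leqP e y); lia. Qed.

Lemma cyc_swap a b c : a != b -> a != c -> b != c -> cyc a c b = ~~ cyc a b c.
Proof. rewrite /cyc; lia. Qed.

Lemma cyc_rev m a b c : (a <= m)%N -> (b <= m)%N -> (c <= m)%N ->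
  cyc (m - a) (m - b) (m - c) = cyc c b a.
Proof. rewrite /cyc; lia. Qed.

Lemma cyc_rot a b c : cyc a b c = cyc b c a.
Proof. rewrite /cyc; lia. Qed.

Lemma cyc_trans a b c d : cyc a b c -> cyc a c d -> cyc a b d && cyc b c d.
Proof. rewrite /cyc; lia. Qed.

Lemma crossing_rev m a b c d : (a <= m)%N -> (b <= m)%N -> (c <= m)%N -> (d <= m)%N ->
  uniq [:: a; b; c; d] ->
  crossing (m - a) (m - b) (m - c) (m - d) = crossing a b c d.
Proof.
move=> am bm cm dm; rewrite /= !inE !negb_or => /and4P[/and3P[ab ac ad] /andP[bc bd] _ _].
rewrite /crossing !cyc_rev // -!(cyc_rot a) (@cyc_swap a b c) // (@cyc_swap a b d) //.
by case: (cyc a b c); case: (cyc a b d).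
Qed.

Lemma crossing_swapl a b c d : uniq [:: a; b; c; d] ->
  crossing b a c d = crossing a b c d.
Proof.
rewrite /= !inE !negb_or => /and4P[/and3P[ab ac ad] /andP[bc bd] _ _].
rewrite /crossing -!(cyc_rot a) (@cyc_swap a b c) // (@cyc_swap a b d) //.
by case: (cyc a b c); case: (cyc a b d).
Qed.

(** With [crossing_only]: exactly one of the three pairings of four points of a
    ring crosses. *)
Lemma crossing_third a b c d : uniq [:: a; b; c; d] ->
  ~~ crossing a b c d -> ~~ crossing a c b d -> crossing a d b c.
Proof.
rewrite /= !inE !negb_or => /and4P[/and3P[ab ac ad] /andP[bc bd] cd _].
rewrite /crossing (@cyc_swap a b c) // (@cyc_swap a b d) // (@cyc_swap a c d) //.
by case: (cyc a b c); case: (cyc a b d); case: (cyc a c d).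
Qed.

Lemma crossing_only a b c d : uniq [:: a; b; c; d] ->
  [&& ~~ (crossing a b c d && crossing a c b d),
      ~~ (crossing a b c d && crossing a d b c) &
      ~~ (crossing a c b d && crossing a d b c)].
Proof.
rewrite /= !inE !negb_or => /and4P[/and3P[ab ac ad] /andP[bc bd] cd _].
have tr : cyc a b c = cyc a c d -> cyc a b d = cyc a b c.
  have := @cyc_trans a b c d; have := @cyc_trans a d c b.
  rewrite (@cyc_swap a b c) // (@cyc_swap a b d) // (@cyc_swap a c d) //.
  case: (cyc a b c); case: (cyc a b d); case: (cyc a c d) => //=.
    by move=> _ /(_ isT isT).
  by move=> /(_ isT isT).
rewrite /crossing (@cyc_swap a b c) // (@cyc_swap a b d) // (@cyc_swap a c d) //.
by move: tr; case: (cyc a b c); case: (cyc a b d); case: (cyc a c d) => // /(_ erefl).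
Qed.

Definition sorted4 a b c d := [&& cyc a b c, cyc a b d, cyc a c d & cyc b c d].

(** Crossing chords do not see the orientation: the cyclic order is determined up
    to a reflection of the ring. *)
Lemma crossing_sorted4 m a b c d :
  (a <= m)%N -> (b <= m)%N -> (c <= m)%N -> (d <= m)%N ->
  uniq [:: a; b; c; d] -> crossing a c b d ->
  sorted4 a b c d || sorted4 (m - a) (m - b) (m - c) (m - d).
Proof.
move=> am bm cm dm; rewrite /= !inE !negb_or => /and4P[/and3P[ab ac ad] /andP[bc bd] cd _].
rewrite /crossing (@cyc_swap a c d) // => cr; have [abc|nabc] := boolP (cyc a b c).
  have acd : cyc a c d by move: cr; rewrite abc; case: (cyc a c d).
  have /andP[h1 h2] := cyc_trans abc acd.
  by rewrite /sorted4 abc acd h1 h2.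
have abc : cyc (m - a) (m - b) (m - c).
  by rewrite cyc_rev // -cyc_rot cyc_swap.
have acd : cyc (m - a) (m - c) (m - d).
  by rewrite cyc_rev // -cyc_rot cyc_swap //; move: cr nabc; case: cyc; case: cyc.
have /andP[h1 h2] := cyc_trans abc acd.
by rewrite /sorted4 abc acd h1 h2 orbT.
Qed.

(** * Inserting a label by ternary search *)

(** The answers of the Four-Index Algorithm are taken to be the true cyclic orders
    of the positions [pos], which are abstract here so that the reflected ring
    can be used in place of the ring itself. *)
Section RingSearch.
Context {R : realType} {m : nat} (n : 'I_m.+1 -> nat).
Variables (T : multi_index n -> R) (q : nat) (pos : 'I_m.+1 -> nat).
Hypothesis pos_inj : injective pos.
Hypothesis four_indexE : forall y i1 i2 i3 i4, uniq [:: i1; i2; i3; i4] ->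
  four_index T q y i1 i2 i3 i4 = Some
   (if crossing (pos i1) (pos i2) (pos i3) (pos i4) then [:: i1; i3; i2; i4]
    else if crossing (pos i1) (pos i3) (pos i2) (pos i4) then [:: i1; i2; i3; i4]
    else [:: i1; i2; i4; i3]).

Implicit Types (s : seq 'I_m.+1) (e a b : 'I_m.+1).

Definition cyclically_sorted s := forall j k l, (j < k < l)%N -> (l < size s)%N ->
  cyc (pos (nth ord0 s j)) (pos (nth ord0 s k)) (pos (nth ord0 s l)).

(** The label e belongs between the entries number g and g + 1 of the cyclic list
    s, where the entries are numbered from 1; g = size s is the gap which closes
    the cycle. *)
Definition gap s e g := (0 < g <= size s)%N /\ forall j k,
  (j < k < size s)%N ->
  cyc (pos (nth ord0 s j)) (pos e) (pos (nth ord0 s k)) = (j < g <= k)%N.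

Lemma pos_eq a b : (pos a == pos b) = (a == b).
Proof. exact: inj_eq. Qed.

(** The gap follows the entry which is met last when the ring is travelled upwards
    from e. *)
Lemma gap_exists s e : (0 < size s)%N -> uniq s -> e \notin s ->
  cyclically_sorted s -> exists g, gap s e g.
Proof.
move=> s0 us es cs.
pose N := (\max_(i : 'I_m.+1) pos i).+1.
have posN i : (pos i < N)%N by rewrite ltnS (leq_bigmax i).
pose x j := offset N (pos e) (pos (nth ord0 s j)).
have [g0 _ gmax] := @arg_maxnP _ (Ordinal s0) xpredT (fun j : 'I_(size s) => x j) isT.
exists g0.+1; split; first by rewrite /= ltn_ord.
have x_inj j k : (j < size s)%N -> (k < size s)%N -> x j = x k -> j = k.
  move=> js ks /(offset_inj (posN e) (posN _) (posN _))/pos_inj/eqP.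
  by rewrite nth_uniq // => /eqP.
have x_gt0 j : (j < size s)%N -> (0 < x j)%N.
  move=> js; rewrite lt0n -[X in _ != X](offset_base N (pos e)); apply: contraNneq es.
  by move=> /(offset_inj (posN e) (posN _) (posN _))/pos_inj <-; rewrite mem_nth.
have cx j k l : (j < k < l)%N -> (l < size s)%N -> cyc (x j) (x k) (x l).
  by move=> jkl ls; rewrite /x cyc_offset //; exact: cs.
have {}gmax j : (j < size s)%N -> (x j <= x g0)%N by move=> js; exact: (gmax (Ordinal js)).
move=> j k /andP[jk ks]; have js := ltn_trans jk ks; have gs := ltn_ord g0.
rewrite -(cyc_offset (posN e)) // offset_base -/(x j) -/(x k).
move: (nat_of_ord g0) gs gmax => g gs gmax.
have [] := (gmax j js, gmax k ks); have [] := (x_gt0 j js, x_gt0 k ks).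
have jg : j = g -> x j = x g by move=> ->.
have kg : k = g -> x k = x g by move=> ->.
have := x_inj _ _ js gs; have := x_inj _ _ ks gs; have := x_inj _ _ js ks.
have := cx j k g; have := cx j g k; have := cx g j k.
move: (x j) (x k) (x g) jg kg => xj xk xg; rewrite /cyc; lia.
Qed.

Lemma equiv4E (x1 x2 x3 x4 : 'I_m.+1) t :
  equiv4 [:: x1; x2; x3; x4] t =
  [|| t == [:: x1; x2; x3; x4], t == [:: x2; x3; x4; x1],
      t == [:: x3; x4; x1; x2], t == [:: x4; x1; x2; x3],
      t == [:: x4; x3; x2; x1], t == [:: x3; x2; x1; x4],
      t == [:: x2; x1; x4; x3] | t == [:: x1; x4; x3; x2]].
Proof.
apply/existsP/idP.
  by case=> -[[|[|[|[|//]]]] lt] /=; rewrite /rot /rev /= => /orP[] ->; rewrite ?orbT.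
do ?[case/orP]; move=> h.
- by exists (@Ordinal 4 0 isT); rewrite /rot /rev /= h.
- by exists (@Ordinal 4 1 isT); rewrite /rot /rev /= h.
- by exists (@Ordinal 4 2 isT); rewrite /rot /rev /= h.
- by exists (@Ordinal 4 3 isT); rewrite /rot /rev /= h.
- by exists (@Ordinal 4 0 isT); rewrite /rot /rev /= h orbT.
- by exists (@Ordinal 4 1 isT); rewrite /rot /rev /= h orbT.
- by exists (@Ordinal 4 2 isT); rewrite /rot /rev /= h orbT.
- by exists (@Ordinal 4 3 isT); rewrite /rot /rev /= h orbT.
Qed.

(** The probed positions are increasing, the gap never precedes the first one, and
    each arc in which the gap may lie is shorter than the current interval. The
    arc from j1 to j2 is long only for the probes (1, t - 1, t), which are used
    when the gap is known to lie after position t - 1. *)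
Lemma probesP t jmin jmax g (j := probes t jmin jmax) :
  (4 <= t)%N -> (0 < jmin <= g)%N -> (g < jmax <= t.+1)%N -> (2 <= jmax - jmin)%N ->
  [/\ (0 < j.1.1 < j.1.2)%N, (j.1.2 < j.2 <= t)%N, (j.1.1 <= g)%N
  & [/\ (g < j.1.2)%N -> (j.1.2 - j.1.1 < jmax - jmin)%N, (j.2 - j.1.2 < jmax - jmin)%N &
    (j.2 <= g)%N -> (jmax - j.2 < jmax - jmin)%N]].
Proof.
move=> t4 jming jmaxg D2; rewrite {}/j /probes; case: ifP => D3.
  have := divn_eq (jmax - jmin) 3; have := divn_eq (2 * (jmax - jmin)) 3.
  have := ltn_pmod (jmax - jmin) (isT : 0 < 3)%N.
  have := ltn_pmod (2 * (jmax - jmin)) (isT : 0 < 3)%N.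
  move: (_ %/ 3)%N (_ %/ 3)%N (_ %% 3)%N (_ %% 3)%N => x1 x2 r1 r2 /=.
  by move=> ? ? ? ?; (split; [lia|lia|lia|split; lia]).
by case: ifP => D4 /=; (split; [lia|lia|lia|split; lia]).
Qed.

Lemma gap_cyc s e g j k : gap s e g -> (0 < j < k)%N -> (k <= size s)%N ->
  cyc (pos (nth ord0 s j.-1)) (pos e) (pos (nth ord0 s k.-1)) = (j <= g < k)%N.
Proof.
by case=> _ gP jk ks; rewrite gP; clear gP; [move: jk; case: j => [|j]; case: k ks => [|k] /=; lia|lia].
Qed.

(** Each query locates the gap in one of the arcs cut out by the three probed
    entries; the loop keeps jmin <= g < jmax and its interval shrinks. *)
Lemma search_stepE y t s jmin jmax g : (4 <= t)%N -> size s = t -> uniq s ->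
  inord t \notin s -> cyclically_sorted s -> gap s (inord t) g ->
  (0 < jmin <= g)%N -> (g < jmax <= t.+1)%N -> (2 <= jmax - jmin)%N ->
  exists jmin' jmax', [/\ search_step T q y t s jmin jmax = Some (jmin', jmax'),
    (0 < jmin' <= g)%N, (g < jmax' <= t.+1)%N & (jmax' - jmin' < jmax - jmin)%N].
Proof.
move=> t4 st us es cs gP jming jmaxg D2.
rewrite /search_step; case E : probes => [[j1 j2] j3].
have := probesP t4 jming jmaxg D2; rewrite E /= => -[b1 b2 b3 [l1 l2 l3]].
set e := inord t; set a := nth ord0 s j1.-1; set b := nth ord0 s j2.-1.
set c := nth ord0 s j3.-1.
have as' : a \in s by rewrite mem_nth // st; clear -b1 b2; lia.
have bs : b \in s by rewrite mem_nth // st; clear -b1 b2; lia.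
have cs' : c \in s by rewrite mem_nth // st; clear -b1 b2; lia.
have ab : a != b by rewrite nth_uniq ?st //; clear -b1 b2; lia.
have ac : a != c by rewrite nth_uniq ?st //; clear -b1 b2; lia.
have bc : b != c by rewrite nth_uniq ?st //; clear -b1 b2; lia.
have ea : e != a by apply: contraNneq es; rewrite -/e => ->.
have eb : e != b by apply: contraNneq es; rewrite -/e => ->.
have ec : e != c by apply: contraNneq es; rewrite -/e => ->.
have c12 : cyc (pos a) (pos e) (pos b) = (j1 <= g < j2)%N.
  by rewrite (gap_cyc gP) ?st //; clear -b1 b2; lia.
have c23 : cyc (pos b) (pos e) (pos c) = (j2 <= g < j3)%N.
  by rewrite (gap_cyc gP) ?st //; clear -b1 b2; lia.
have c13 : cyc (pos a) (pos e) (pos c) = (j1 <= g < j3)%N.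
  by rewrite (gap_cyc gP) ?st //; clear -b1 b2; lia.
rewrite four_indexE; last by rewrite /= !inE !negb_or ea eb ec ab ac bc.
have -> : crossing (pos e) (pos a) (pos b) (pos c) = (j2 <= g < j3)%N.
  by rewrite crossing_base ?pos_eq // c12 c13; clear -b1 b2; lia.
have -> : crossing (pos e) (pos b) (pos a) (pos c) = ~~ (j1 <= g < j3)%N.
  rewrite crossing_base ?pos_eq // c23 cyc_flip ?pos_eq // 1?eq_sym //.
  by rewrite c12; clear -b1 b2; lia.
have ba : b != a by rewrite eq_sym.
have ca : c != a by rewrite eq_sym.
have cb : c != b by rewrite eq_sym.
have ae : a != e by rewrite eq_sym.
have be : b != e by rewrite eq_sym.
have ce : c != e by rewrite eq_sym.
pose neqs := (negPf ab, negPf ac, negPf bc, negPf ea, negPf eb, negPf ec,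
              negPf ba, negPf ca, negPf cb, negPf ae, negPf be, negPf ce).
case h: (j2 <= g < j3)%N => /=.
  rewrite !equiv4E !eqE /= !neqs !eqxx /= ?andbF ?orbT /=.
  by exists j2, j3; split=> //; clear -jming jmaxg b1 b2 b3 l1 l2 l3 h; lia.
case h': (~~ (j1 <= g < j3))%N => /=.
  rewrite !equiv4E !eqE /= !neqs !eqxx /= ?andbF ?orbT /=.
  by exists j3, jmax; split=> //; clear -jming jmaxg b1 b2 b3 l1 l2 l3 h h'; lia.
rewrite !equiv4E !eqE /= !neqs !eqxx /= ?andbF ?orbT /=.
by exists j1, j2; split=> //; clear -jming jmaxg b1 b2 b3 l1 l2 l3 h h'; lia.
Qed.

Variable Y : nat -> multi_index n.

Lemma search_gap t s c jmin jmax c' jmin' jmax' g :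
  (4 <= t)%N -> size s = t -> uniq s -> inord t \notin s ->
  cyclically_sorted s -> gap s (inord t) g ->
  search T q Y t s c jmin jmax c' jmin' jmax' ->
  (0 < jmin <= g)%N -> (g < jmax <= t.+1)%N -> jmin' = g /\ jmax' = g.+1.
Proof.
move=> t4 st us es cs gP; elim => {c jmin jmax c' jmin' jmax'}.
  by move=> c jmin jmax lt2 b1 b2; lia.
move=> c jmin jmax jmin1 jmax1 c' jmin' jmax' D2 E _ IH b1 b2.
have [j [j' [E' b3 b4 _]]] := search_stepE (Y c) t4 st us es cs gP b1 b2 D2.
by move: E'; rewrite E => -[? ?]; subst; apply: IH.
Qed.

Lemma search_total t s c jmin jmax g :
  (4 <= t)%N -> size s = t -> uniq s -> inord t \notin s ->
  cyclically_sorted s -> gap s (inord t) g ->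
  (0 < jmin <= g)%N -> (g < jmax <= t.+1)%N ->
  exists c' jmin' jmax', search T q Y t s c jmin jmax c' jmin' jmax'.
Proof.
move=> t4 st us es cs gP.
have [D] := ubnP (jmax - jmin); elim: D c jmin jmax => // D IH c jmin jmax DD b1 b2.
case: (ltnP (jmax - jmin) 2) => D2.
  by exists c, jmin, jmax; exact: search_exit.
have [j [j' [E b3 b4 lt]]] := search_stepE (Y c) t4 st us es cs gP b1 b2 D2.
have [|c' [k [k' kP]]] := IH c.+1 j j' _ b3 b4; first by lia.
by exists c', k, k'; exact: search_next kP.
Qed.

Lemma insert_sorted t s g : uniq s -> inord t \notin s -> cyclically_sorted s ->
  gap s (inord t) g -> cyclically_sorted (insert_label t s g g.+1).
Proof.
move=> us es cs [/andP[g0 gs] gP].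
have nthE j : nth ord0 (insert_label t s g g.+1) j =
    if (j < g)%N then nth ord0 s j else if j == g then inord t else nth ord0 s j.-1.
  rewrite /insert_label nth_cat size_take_min (minn_idPl gs) /=.
  case: ltnP => jg; first by rewrite nth_take.
  case: eqVneq => [->|jg']; first by rewrite subnn.
  have -> : (j - g)%N = (j.-1 - g).+1 by lia.
  by rewrite /= nth_drop; congr nth; lia.
have sE : size (insert_label t s g g.+1) = (size s).+1.
  by rewrite /insert_label size_cat size_take_min (minn_idPl gs) /= size_drop; lia.
move=> j k l jkl; rewrite sE => ls; rewrite !nthE.
have pe i : (i < size s)%N -> pos (nth ord0 s i) != pos (inord t).
  by move=> si; rewrite pos_eq; apply: contraNneq es => <-; rewrite mem_nth.
have px i i' : (i < i' < size s)%N -> pos (nth ord0 s i) != pos (nth ord0 s i').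
  move=> /andP[ii' si']; rewrite pos_eq nth_uniq ?ltn_eqF //.
  exact: ltn_trans si'.
case: (ltngtP j g) => jg; case: (ltngtP k g) => kg; case: (ltngtP l g) => lg; try lia.
- by apply: cs; lia.
- by apply: cs; lia.
- have := gP j k; have := pe j; have := pe k; have := px j k.
  move: (pos _) (pos _) (pos _) => a b c; rewrite /cyc; lia.
- by apply: cs; lia.
- have := gP j l.-1; move: (pos _) (pos _) (pos _) => a b c; rewrite /cyc; lia.
- by apply: cs; lia.
have := gP k.-1 l.-1; have := pe k.-1; have := pe l.-1; have := px k.-1 l.-1.
move: (pos _) (pos _) (pos _) => a b c; rewrite /cyc; lia.
Qed.

(** The state of the outer loop when t labels have been placed. *)
Definition ring_list t s := [/\ size s = t, uniq s, cyclically_sorted s &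
  forall i, i \in s -> (i < t)%N].

Lemma ring_list_fresh t s : (t < m.+1)%N -> ring_list t s -> inord t \notin s.
Proof.
by move=> tm [_ _ _ sP]; apply/negP => /sP; rewrite inordK // ltnn.
Qed.

Lemma ring_list_insert t s g : (t < m.+1)%N -> ring_list t s -> gap s (inord t) g ->
  ring_list t.+1 (insert_label t s g g.+1).
Proof.
move=> tm sP gP; have es := ring_list_fresh tm sP; case: sP => st us cs sP.
have pE : perm_eq (insert_label t s g g.+1) (inord t :: s).
  by rewrite /insert_label /= perm_catC /= perm_cons perm_catC cat_take_drop.
split.
- by rewrite (perm_size pE) /= st.
- by rewrite (perm_uniq pE) /= es.
- exact: insert_sorted.
move=> i; rewrite (perm_mem pE) inE => /predU1P[->|/sP]; last by move/leqW.
by rewrite inordK.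
Qed.

Lemma grow_ring_list c t s s' : grow T q Y c t s s' -> (4 <= t <= m.+1)%N ->
  ring_list t s -> ring_list m.+1 s'.
Proof.
elim => {c t s s'} [c t s tm b sP|c t s c' jmin jmax s' tm sr _ IH b sP].
  by have -> : m.+1 = t by lia.
have es := ring_list_fresh tm sP; have [st us cs _] := sP.
have [g gP] : exists g, gap s (inord t) g by apply: gap_exists => //; lia.
have gb := gP.1.
have [j1 j2] : jmin = g /\ jmax = g.+1 by apply: (search_gap _ st us es cs gP sr); lia.
by subst jmin jmax; apply: IH; [lia|exact: ring_list_insert].
Qed.

Lemma grow_total c t s : (4 <= t <= m.+1)%N -> ring_list t s ->
  exists s', grow T q Y c t s s'.
Proof.
have [D] := ubnP (m.+1 - t); elim: D c t s => // D IH c t s DD b sP.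
case: (ltnP t m.+1) => tm; last by exists s; exact: grow_exit.
have es := ring_list_fresh tm sP; have [st us cs _] := sP.
have [g gP] : exists g, gap s (inord t) g by apply: gap_exists => //; lia.
have gb := gP.1.
have [c' [j [j' sr]]] : exists c' j j', search T q Y t s c 1 t.+1 c' j j'.
  by apply: (search_total c _ st us es cs gP); lia.
have [jE j'E] : j = g /\ j' = g.+1 by apply: (search_gap _ st us es cs gP sr); lia.
subst j j'.
have [||s' gs'] := IH c' t.+1 _ _ _ (ring_list_insert tm sP gP); [lia|lia|].
by exists s'; apply: grow_next sr gs'.
Qed.

End RingSearch.

(** * From the cyclic order to the equivalence class *)

Section CyclicPerms.
Variable m : nat.
Implicit Types (f tau : 'S_m.+1) (j k : 'I_m.+1).

Lemma rotationX (k : nat) j : (rotation ^+ k)%g j = ((j + k) %% m.+1)%N :> nat.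
Proof.
rewrite permX -iter_ordS; congr nat_of_ord.
by apply: eq_iter => i; rewrite permE.
Qed.

(** A bijection preserving the cyclic order commutes with the successor: the
    preimage of the successor of f j would otherwise lie outside the empty arc
    from j to its successor, while its image lies between theirs. *)
Lemma cyclic_perm_rotation f :
  (forall i j k : 'I_m.+1, (i < j < k)%N -> cyc (f i) (f j) (f k)) ->
  exists k, f = (rotation ^+ nat_of_ord k)%g.
Proof.
move=> fcyc.
have {}fcyc (i j k : 'I_m.+1) : cyc i j k -> cyc (f i) (f j) (f k).
  case/or3P => h; first exact: fcyc.
    by have := fcyc _ _ _ h; rewrite /cyc; lia.
  by have := fcyc _ _ _ h; rewrite /cyc; lia.
have [m0|m_gt0] := posnP m.
  exists ord0; rewrite expg0; apply/permP => j; rewrite perm1; apply: val_inj.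
  by have := ltn_ord j; have := ltn_ord (f j); move: m0 => /=; lia.
have ordSE (i : 'I_m.+1) : ordS i = (if i == m :> nat then 0 else i.+1) :> nat.
  rewrite /=; case: eqP => [->|im]; first by rewrite modnn.
  by rewrite modn_small //; have := ltn_ord i; lia.
have fS j : f (ordS j) = ordS (f j).
  apply/eqP; apply: contraT => ne.
  pose x := (f^-1)%g (ordS (f j)); have fx : f x = ordS (f j) by rewrite permKV.
  have xj : x != j.
    apply: contraTneq isT => xj; move: fx; rewrite xj => /(congr1 (@nat_of_ord _)).
    rewrite ordSE; case: eqP; lia.
  have xS : x != ordS j by apply: contraNneq ne => <-; rewrite fx.
  have : cyc j (ordS j) x.
    move: xj xS; rewrite -!val_eqE /= -[(_ %% _)%N]/(ordS j : nat) ordSE /cyc.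
    have := ltn_ord x; have := ltn_ord j; by case: (eqVneq (nat_of_ord j) m); lia.
  move/fcyc; move: ne; rewrite fx -val_eqE /= -[(_ %% _)%N]/(ordS (f j) : nat).
  rewrite /cyc ordSE; have := ltn_ord (f j); have := ltn_ord (f (ordS j)).
  by case: (eqVneq (nat_of_ord (f j)) m); lia.
exists (f ord0); apply/permP => j; apply: val_inj; rewrite /= rotationX.
case: j => j jm; elim: j jm => [|j IH] jm.
  by rewrite add0n modn_small // (_ : Ordinal jm = ord0) //; exact: val_inj.
have jm' := ltnW jm.
rewrite (_ : Ordinal jm = ordS (Ordinal jm')); last first.
  by apply: val_inj; rewrite /= modn_small.
by rewrite fS /= IH -(addn1 (_ %% _)) !modnDml addn1 addSn.
Qed.

Lemma reflectionE j : reflection j = (m - j)%N :> nat.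
Proof. by rewrite permE /= subSS. Qed.

Lemma reflectionK : (reflection * reflection = 1 :> 'S_m.+1)%g.
Proof. by apply/permP => j; rewrite permM perm1 !permE rev_ordK. Qed.

Lemma rotation_reflection k : exists k' : 'I_m.+1,
  (rotation ^+ nat_of_ord k * reflection = reflection * rotation ^+ nat_of_ord k' :> 'S_m.+1)%g.
Proof.
exists (Ordinal (ltn_pmod (m.+1 - k) (ltn0Sn m))).
apply/permP => j; rewrite !permM; apply: val_inj; rewrite /= reflectionE rotationX.
rewrite rotationX reflectionE /= modnDmr.
have := ltn_ord j; have := ltn_ord k; rewrite !ltnS => km jm.
case: (leqP (j + k) m) => h.
  rewrite (@modn_small (j + k)) ?ltnS //.
  have -> : (m - j + (m.+1 - k) = m - (j + k) + m.+1)%N by lia.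
  by rewrite modnDr modn_small // ltnS leq_subr.
have -> : (j + k = (j + k - m.+1) + m.+1)%N by lia.
rewrite modnDr (@modn_small (j + k - _)); last by lia.
by rewrite modn_small; lia.
Qed.

(** The position of a label on the ring, read backwards if b holds. *)
Definition ring_pos tau (b : bool) (i : 'I_m.+1) : nat :=
  if b then (m - (tau^-1)%g i)%N else (tau^-1)%g i.

Lemma ring_pos_inj tau b : injective (ring_pos tau b).
Proof.
move=> i j; rewrite /ring_pos; case: b => h; apply: (@perm_inj _ (tau^-1)%g); apply: val_inj => //=.
have := ltn_ord ((tau^-1)%g i); have := ltn_ord ((tau^-1)%g j).
by move: h => /=; lia.
Qed.

(** The positions of the listed labels run through the ring by rotation, so tau' is
    tau after this rotation and, if b holds, the reflection. *)
Lemma CS_TR_cyclic tau tau' b :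
  cyclically_sorted (ring_pos tau b) [seq tau' j | j <- enum 'I_m.+1] ->
  tau' \in CS_TR tau.
Proof.
move=> cs.
have [k kE] : exists k, (tau' * tau^-1 * reflection ^+ b = rotation ^+ nat_of_ord k)%g.
  apply: cyclic_perm_rotation => i j k ijk.
  have nthE (l : 'I_m.+1) : nth ord0 [seq tau' j | j <- enum 'I_m.+1] l = tau' l.
    by rewrite (nth_map ord0) ?size_enum_ord // nth_ord_enum.
  have := cs i j k ijk; rewrite size_map size_enum_ord ltn_ord !nthE => /(_ isT).
  have E l : (tau' * tau^-1 * reflection ^+ b)%g l = ring_pos tau b (tau' l) :> nat.
    rewrite /ring_pos; case: b {cs}; last by rewrite expg0 mulg1 permM.
    by rewrite expg1 permM reflectionE permM.
  by rewrite !E.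
have tE : (tau' = rotation ^+ nat_of_ord k * reflection ^+ b * tau)%g.
  rewrite -kE; case: b {cs kE}; last by rewrite !expg0 !mulg1 mulgKV.
  by rewrite expg1 -(mulgA _ reflection reflection) reflectionK mulg1 mulgKV.
rewrite tE; case: b {cs kE tE}.
  have [k' ->] := rotation_reflection k.
  by apply/imset2P; exists k' (@Ordinal 2 1 isT).
by apply/imset2P; exists k ord0; rewrite // expg0 mulg1 mul1g.
Qed.

Section Recovery.
Context {R : realType} (n : 'I_m.+1 -> nat).
Variables (T : multi_index n -> R) (q : nat) (tau : 'S_m.+1).
Let p := ring_pos tau false.
Hypothesis four_indexE : forall y i1 i2 i3 i4, uniq [:: i1; i2; i3; i4] ->
  four_index T q y i1 i2 i3 i4 = Some
   (if crossing (p i1) (p i2) (p i3) (p i4) then [:: i1; i3; i2; i4]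
    else if crossing (p i1) (p i3) (p i2) (p i4) then [:: i1; i2; i3; i4]
    else [:: i1; i2; i4; i3]).

(** Reversing the ring does not change which pairing crosses. *)
Lemma four_indexE_ring_pos b y i1 i2 i3 i4 (p' := ring_pos tau b) :
  uniq [:: i1; i2; i3; i4] ->
  four_index T q y i1 i2 i3 i4 = Some
   (if crossing (p' i1) (p' i2) (p' i3) (p' i4) then [:: i1; i3; i2; i4]
    else if crossing (p' i1) (p' i3) (p' i2) (p' i4) then [:: i1; i2; i3; i4]
    else [:: i1; i2; i4; i3]).
Proof.
move=> u; rewrite four_indexE // /p'; case: b {p'} => //.
have pu x1 x2 x3 x4 : uniq [:: x1; x2; x3; x4] -> uniq [:: p x1; p x2; p x3; p x4].
  by rewrite -(map_inj_uniq (@ring_pos_inj tau false)).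
have pm i : (p i <= m)%N by rewrite -ltnS /p /ring_pos ltn_ord.
have u' : uniq [:: i1; i3; i2; i4].
  move: u; rewrite /= !inE !negb_or (eq_sym i3 i2).
  by move=> /and4P[/and3P[-> -> ->] /andP[-> ->] -> _].
by rewrite -(@crossing_rev m) ?pu // -(@crossing_rev m (p i1) (p i3)) ?pu.
Qed.

(** The first four labels fix the orientation b used for the rest of the run. *)
Lemma four_index_start y : (4 <= m.+1)%N -> exists b s0,
  four_index T q y (inord 0) (inord 1) (inord 2) (inord 3) = Some s0 /\
  ring_list (ring_pos tau b) 4 s0.
Proof.
move=> m4; set i1 := inord 0; set i2 := inord 1; set i3 := inord 2; set i4 := inord 3.
have v1 : i1 = 0%N :> nat by rewrite inordK.
have v2 : i2 = 1%N :> nat by rewrite inordK //; lia.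
have v3 : i3 = 2%N :> nat by rewrite inordK //; lia.
have v4 : i4 = 3%N :> nat by rewrite inordK //; lia.
have u : uniq [:: i1; i2; i3; i4] by rewrite /= !inE -!val_eqE /= v1 v2 v3 v4.
have lt4 i : i \in [:: i1; i2; i3; i4] -> (i < 4)%N.
  by rewrite !inE => /or4P[] /eqP ->; rewrite ?v1 ?v2 ?v3 ?v4.
rewrite four_indexE //.
have sorted4P (pos : 'I_m.+1 -> nat) x1 x2 x3 x4 :
    sorted4 (pos x1) (pos x2) (pos x3) (pos x4) ->
    cyclically_sorted pos [:: x1; x2; x3; x4].
  case/and4P => c1 c2 c3 c4 [|[|[|[|j]]]] [|[|[|[|k]]]] [|[|[|[|l]]]] //=; lia.
have ringl b x1 x2 x3 x4 : perm_eq [:: x1; x2; x3; x4] [:: i1; i2; i3; i4] ->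
    cyclically_sorted (ring_pos tau b) [:: x1; x2; x3; x4] ->
    ring_list (ring_pos tau b) 4 [:: x1; x2; x3; x4].
  by move=> pE cs; split=> //; [rewrite (perm_uniq pE)|move=> i; rewrite (perm_mem pE) => /lt4].
have key x1 x2 x3 x4 : perm_eq [:: x1; x2; x3; x4] [:: i1; i2; i3; i4] ->
    crossing (p x1) (p x3) (p x2) (p x4) ->
    exists b s0, Some [:: x1; x2; x3; x4] = Some s0 /\ ring_list (ring_pos tau b) 4 s0.
  move=> pE cr; have ux : uniq [:: x1; x2; x3; x4] by rewrite (perm_uniq pE).
  have pm i : (p i <= m)%N by rewrite -ltnS /p /ring_pos ltn_ord.
  have pu : uniq [:: p x1; p x2; p x3; p x4].
    by rewrite -(map_inj_uniq (@ring_pos_inj tau false)) in ux.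
  have [b bP] : exists b, sorted4 (ring_pos tau b x1) (ring_pos tau b x2)
      (ring_pos tau b x3) (ring_pos tau b x4).
    by case/orP: (crossing_sorted4 (pm x1) (pm x2) (pm x3) (pm x4) pu cr) => h;
      [exists false|exists true].
  by exists b, [:: x1; x2; x3; x4]; split=> //; apply: ringl => //; exact: sorted4P.
case: ifP => [c1|c1].
  apply: key => //.
  by apply: uniq_perm => //; [move: u; rewrite /= !inE -!val_eqE /= v1 v2 v3 v4|
    move=> i; rewrite !inE; do 4 case: (_ == _)].
case: ifP => [c2|c2]; first by apply: key.
apply: key.
  by apply: uniq_perm => //; [move: u; rewrite /= !inE -!val_eqE /= v1 v2 v3 v4|
    move=> i; rewrite !inE; do 4 case: (_ == _)].
apply: crossing_third; rewrite ?c1 ?c2 //.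
by rewrite -(map_inj_uniq (@ring_pos_inj tau false)) in u.
Qed.

Lemma ring_recovery_correct (Y : nat -> multi_index n) : (4 <= m.+1)%N ->
  (exists tau', ring_recovery T q Y tau') /\
  (forall tau', ring_recovery T q Y tau' -> tau' \in CS_TR tau).
Proof.
move=> m4; have [b [s0 [E rl0]]] := four_index_start (Y 0) m4.
have orc := four_indexE_ring_pos b; have pinj := @ring_pos_inj tau b.
split.
  have [s gs] : exists s, grow T q Y 1 4 s0 s by apply: (grow_total pinj orc) rl0; lia.
  have [ss us _ _] := grow_ring_list pinj orc gs m4 rl0.
  have inj : injective (fun j : 'I_m.+1 => nth ord0 s j).
    by move=> j k /eqP; rewrite nth_uniq ?ss // => /eqP/val_inj.
  exists (perm inj), s0, s; split=> //.
  apply: (@eq_from_nth _ ord0); first by rewrite size_map size_enum_ord.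
  move=> j js; rewrite ss in js.
  by rewrite (nth_map ord0) ?size_enum_ord // permE nth_enum_ord.
move=> tau' [s1 [s [E' gs sE]]]; move: E' gs; rewrite E sE => -[<-] gs.
by apply: (CS_TR_cyclic (b := b)); have [_ _ + _] := grow_ring_list pinj orc gs m4 rl0.
Qed.

End Recovery.
End CyclicPerms.

(** * The tensor as a trace of square matrices *)

(** The cores have dependent sizes; bordered with zeros they become elements of one
    matrix ring, where products over arcs of the ring are ordinary products. *)
Section PaddedCores.
Context {R : realType} {m : nat} (n r : 'I_m.+1 -> nat) (tau : 'S_m.+1).
Variable K : nat.
Hypothesis r_le : forall j, (r j <= K.+1)%N.
Implicit Types (u : core_entry n r tau -> R) (x : multi_index n).

Definition pad j : 'M[R]_(r j, K.+1) := \matrix_(a, b) (a == b :> nat)%:R.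

Lemma padK j : pad j *m (pad j)^T = 1%:M.
Proof.
apply/matrixP => a b; rewrite !mxE (bigD1 (widen_ord (r_le j) a)) //= big1.
  by rewrite !mxE /= eqxx mul1r addr0 eq_sym.
by move=> c; rewrite -val_eqE /= !mxE eq_sym => /negPf ->; rewrite mul0r.
Qed.

Definition padded_core u x j : 'M[R]_K.+1 :=
  (pad j)^T *m ring_core u x j *m pad (ordS j).

(** Written as in [ring_prod], so that the types of consecutive factors match. *)
Definition position k : 'I_m.+1 := iter k (@ordS m.+1) ord0.

Lemma position_val k : (k < m.+1)%N -> position k = k :> nat.
Proof. by move=> km; rewrite /position iter_ordS add0n modn_small. Qed.

Lemma positionE (j : 'I_m.+1) : position j = j.
Proof. by apply: val_inj; rewrite /= position_val. Qed.

Definition arc u x a b : 'M[R]_K.+1 := \prod_(a <= k < b) padded_core u x (position k).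

Lemma pad_core u x j : (pad j)^T *m pad j *m padded_core u x j = padded_core u x j.
Proof. by rewrite /padded_core !mulmxA -(mulmxA _ (pad j)) padK mulmx1. Qed.

Lemma core_pad u x j :
  padded_core u x j *m (pad (ordS j))^T *m pad (ordS j) = padded_core u x j.
Proof. by rewrite /padded_core -(mulmxA _ (pad _)) padK mulmx1. Qed.

(** Each factor ends with the padding which the next one starts with, and these
    cancel. *)
Lemma pad_ring_prod u x k :
  pad ord0 *m arc u x 0 k = ring_prod u x k *m pad (position k).
Proof.
elim: k => [|k IH]; first by rewrite /arc big_geq // mulmx1 mul1mx.
rewrite /arc big_nat_recr //= -mulmxE mulmxA -/(arc u x 0 k) IH /padded_core.
by rewrite !mulmxA -(mulmxA _ (pad _)) padK mulmx1.
Qed.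

Lemma pad_arc u x a b : (a < b)%N ->
  (pad (position a))^T *m pad (position a) *m arc u x a b = arc u x a b.
Proof. by move=> ab; rewrite /arc big_ltn // -mulmxE mulmxA pad_core. Qed.

Lemma arc_pad u x a b : (a < b)%N ->
  arc u x a b *m (pad (position b))^T *m pad (position b) = arc u x a b.
Proof.
case: b => // b ab; rewrite /arc big_nat_recr //= -mulmxE.
have E (X C : 'M[R]_K.+1) l (P : 'M[R]_(K.+1, l)) (Q : 'M[R]_(l, K.+1)) :
  C *m P *m Q = C -> X *m C *m P *m Q = X *m C by move=> e; rewrite -[in RHS]e !mulmxA.
exact/E/core_pad.
Qed.

Lemma arc_cat u x a b c : (a <= b)%N -> (b <= c)%N ->
  arc u x a c = arc u x a b *m arc u x b c.
Proof. by move=> ab bc; rewrite /arc (big_cat_nat (n := b)). Qed.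

Lemma mxtrace_cast_pad (j : 'I_m.+1) (e : j = ord0) (A : 'M[R]_(r ord0, r j)) :
  \tr (castmx (erefl, congr1 r e) A) = \tr (A *m pad j *m (pad ord0)^T).
Proof. by subst j; rewrite castmx_id -mulmxA padK mulmx1. Qed.

Lemma tensor_ringE u x : tensor_ring u x = \tr (arc u x 0 m.+1).
Proof.
rewrite /tensor_ring mxtrace_cast_pad -pad_ring_prod mxtrace_mulC mulmxA.
by rewrite (pad_arc u x (ltn0Sn m)).
Qed.

Lemma eq_arc u x x' a b :
  (forall k, (a <= k < b)%N -> x (tau (position k)) = x' (tau (position k))) ->
  arc u x a b = arc u x' a b.
Proof.
move=> xx'; apply: eq_big_nat => k /xx' e.
by rewrite /padded_core /ring_core e.
Qed.

(** If A lives on the rows kept by P and the columns kept by Q, its trace against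
    C is computed by small matrices. *)
Lemma mxtrace_project k l (A C : 'M[R]_K.+1) (P : 'M[R]_(k, K.+1)) (Q : 'M[R]_(l, K.+1)) :
  P^T *m P *m A = A -> A *m Q^T *m Q = A ->
  \tr (A *m C) = \tr ((P *m A *m Q^T) *m (Q *m C *m P^T)).
Proof.
move=> PA AQ; rewrite -[in LHS]PA -!mulmxA [LHS]mxtrace_mulC -!mulmxA.
by rewrite -[in LHS]AQ !mulmxA.
Qed.

(** Cutting the ring at the bonds before positions a and b separates the tensor
    into a sum, over the values at these two bonds, of products of a function of
    the indices inside the arc and a function of those outside. *)
Lemma tensor_ring_cut u a b : (a < b <= m.+1)%N ->
  exists F G : 'I_(r (position a)) * 'I_(r (position b)) -> multi_index n -> R,
  [/\ forall x, tensor_ring u x = \sum_s F s x * G s x,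
      forall s x x', (forall i, (a <= (tau^-1)%g i < b)%N -> x i = x' i) ->
        F s x = F s x' &
      forall s x x', (forall i, ~~ (a <= (tau^-1)%g i < b)%N -> x i = x' i) ->
        G s x = G s x'].
Proof.
move=> /andP[ab bm].
pose A x := pad (position a) *m arc u x a b *m (pad (position b))^T.
pose B x := pad (position b) *m (arc u x b m.+1 *m arc u x 0 a) *m (pad (position a))^T.
have posK k : (k < m.+1)%N -> (tau^-1)%g (tau (position k)) = k :> nat.
  by move=> km; rewrite permK position_val.
exists (fun s x => A x s.1 s.2), (fun s x => B x s.2 s.1); split.
- move=> x; rewrite tensor_ringE (arc_cat _ _ (leq0n a)) ?(leq_trans (ltnW ab)) //.
  rewrite (arc_cat _ _ (ltnW ab) bm) mxtrace_mulC -mulmxA.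
  rewrite (mxtrace_project _ (pad_arc u x ab) (arc_pad u x ab)) -/(A x) -/(B x).
  rewrite -(pair_bigA _ (fun i j => A x i j * B x j i)) /=.
  by apply: eq_bigr => i _; rewrite mxE.
- move=> s x x' xx'; rewrite /A (@eq_arc u x x') // => k /andP[ak kb].
  by apply: xx'; rewrite posK ?ak // (leq_trans kb).
move=> s x x' xx'; rewrite /B (@eq_arc u x x' b) ?(@eq_arc u x x' 0) //.
  move=> k /andP[_ ka]; apply: xx'; rewrite posK ?negb_and -?ltnNge ?ka //.
  by rewrite (ltn_trans ka) // (leq_trans ab).
move=> k /andP[bk km]; apply: xx'; rewrite posK // negb_and -(leqNgt b) bk orbT //.
Qed.

Lemma padded_coreE u x j (a : 'I_(r j)) (b : 'I_(r (ordS j))) (c d : 'I_K.+1) :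
  c = a :> nat -> d = b :> nat -> padded_core u x j c d = ring_core u x j a b.
Proof.
move=> ca db; rewrite /padded_core -mulmxA !mxE (bigD1 a) //= big1 ?addr0.
  rewrite !mxE -ca eqxx mul1r (bigD1 b) //= big1 ?addr0.
    by rewrite !mxE -db eqxx mulr1.
  by move=> b' ne; rewrite !mxE db val_eqE (negPf ne) mulr0.
by move=> a' ne; rewrite !mxE ca val_eqE (negPf ne) mul0r.
Qed.

Lemma padded_core_outl u x j (c d : 'I_K.+1) : (r j <= c)%N -> padded_core u x j c d = 0.
Proof.
move=> rc; rewrite /padded_core -mulmxA !mxE big1 // => a _; rewrite !mxE.
by rewrite ltn_eqF ?mul0r // (leq_trans (ltn_ord a)).
Qed.

Lemma padded_core_outr u x j (c d : 'I_K.+1) :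
  (r (ordS j) <= d)%N -> padded_core u x j c d = 0.
Proof.
move=> rd; rewrite /padded_core !mxE big1 // => a _; rewrite !mxE.
by rewrite ltn_eqF ?mulr0 // (leq_trans (ltn_ord a)).
Qed.

End PaddedCores.

(** * Ranks of the matricizations *)

Lemma mxrank_sum_products (F : fieldType) (S : finType) k l (M : 'M[F]_(k, l))
    (f : 'I_k -> S -> F) (g : S -> 'I_l -> F) :
  (forall i j, M i j = \sum_s f i s * g s j) -> (\rank M <= #|S|)%N.
Proof.
move=> ME.
have -> : M = (\matrix_(i < k, s < #|S|) f i (enum_val s)) *m
              (\matrix_(s < #|S|, j < l) g (enum_val s) j).
  apply/matrixP => i j; rewrite ME mxE big_enum_val.
  by apply: eq_bigr => s _; rewrite !mxE.
exact: mulmx_max_rank.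
Qed.

Lemma mxrank_mxsub (F : fieldType) k l k' l' (f : 'I_k' -> 'I_k) (g : 'I_l' -> 'I_l)
  (M : 'M[F]_(k, l)) : (\rank (mxsub f g M) <= \rank M)%N.
Proof.
have -> : mxsub f g M = (rowsub g (rowsub f M)^T)^T by apply/matrixP => i j; rewrite !mxE.
rewrite mxrank_tr; apply: leq_trans (mxrankS (rowsub_sub _ _)) _.
by rewrite mxrank_tr; exact: mxrankS (rowsub_sub _ _).
Qed.

Lemma dfwithC (I : eqType) (T : I -> Type) (f : forall i, T i) i j (x : T i) (z : T j) :
  i != j -> dfwith (dfwith f i x) j z = dfwith (dfwith f j z) i x.
Proof.
move=> ij; apply: functional_extensionality_dep => k.
have [ki|ki] := eqVneq i k.
  by subst k; rewrite dfwithin dfwithout 1?eq_sym // dfwithin.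
have [kj|kj] := eqVneq j k.
  by subst k; rewrite dfwithin dfwithout // dfwithin.
by rewrite !dfwithout.
Qed.

Section Pairings.
Context {R : realType} {m : nat} (n : 'I_m.+1 -> nat) (T : multi_index n -> R).
Variables (y : multi_index n) (i1 i2 i3 i4 : 'I_m.+1).
Hypothesis uniq_i : uniq [:: i1; i2; i3; i4].

Let distinct : [/\ i1 != i2, i1 != i3, i1 != i4 & [/\ i2 != i3, i2 != i4 & i3 != i4]].
Proof.
by move: uniq_i; rewrite /= !inE !negb_or => /and4P[/and3P[-> -> ->] /andP[-> ->] ->].
Qed.

Lemma mx13_24E : mx13_24 T y i1 i2 i3 i4 = mx12_34 T y i1 i3 i2 i4.
Proof.
have [_ _ _ [h _ _]] := distinct.
by apply/matrixP => a b; rewrite !mxE /slice (dfwithC _ _ _ h).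
Qed.

Lemma mx14_23E : mx14_23 T y i1 i2 i3 i4 = mx12_34 T y i1 i4 i2 i3.
Proof.
have [_ _ _ [_ h h']] := distinct.
by apply/matrixP => a b; rewrite !mxE /slice (dfwithC _ _ _ h') (dfwithC _ _ _ h).
Qed.
End Pairings.

Section LowRank.
Context {R : realType} {m : nat} (n r : 'I_m.+1 -> nat) (tau : 'S_m.+1) (q : nat).
Hypothesis r_lt : forall j, (r j < q ^ 2)%N.
Variables (u : core_entry n r tau -> R) (y : multi_index n).
Let p i : nat := (tau^-1)%g i.

(** If the pairing does not cross, some arc contains one of the two pairs and avoids
    the other, so the rank is at most the product of the two bond dimensions at
    its ends, which is less than q ^ 2 * q ^ 2. *)
Lemma mxrank_low i1 i2 i3 i4 : uniq [:: i1; i2; i3; i4] ->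
  ~~ crossing (p i1) (p i2) (p i3) (p i4) ->
  (\rank (mx12_34 (tensor_ring u) y i1 i2 i3 i4) < q ^ 4)%N.
Proof.
move=> ui ncr.
have pinj : injective p by move=> i j /val_inj/perm_inj.
have [a [b [abm side]]] : exists a b, (a < b <= m.+1)%N /\
    ([/\ (a <= p i1 < b), (a <= p i2 < b), ~~ (a <= p i3 < b) & ~~ (a <= p i4 < b)]%N \/
     [/\ ~~ (a <= p i1 < b), ~~ (a <= p i2 < b), (a <= p i3 < b) & (a <= p i4 < b)]%N).
  have pm i : (p i < m.+1)%N := ltn_ord _.
  move: ncr (pm i1) (pm i2) (pm i3) (pm i4) ui.
  rewrite -(map_inj_uniq pinj) /= !inE !negb_or.
  move: (p i1) (p i2) (p i3) (p i4) => p1 p2 p3 p4 ncr m1 m2 m3 m4.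
  case/and4P => /and3P[d12 d13 d14] /andP[d23 d24] d34 _.
  pose a := minn p1 p2; pose b := maxn p1 p2.
  (* The other pair lies outside the chord p1 p2, or inside it. *)
  have [out|inn] := boolP ((p3 < a) || (b < p3))%N.
    exists a, b.+1; split; first by rewrite /a /b; lia.
    left; move: ncr out; rewrite /crossing /cyc /a /b; case: (ltngtP p1 p2) d12 => // lt _ ncr out.
      by split; lia.
    by split; lia.
  exists a.+1, b; split; first by move: inn; rewrite /a /b; lia.
  right; move: ncr inn; rewrite /crossing /cyc /a /b; case: (ltngtP p1 p2) d12 => // lt _ ncr inn.
    by split; lia.
  by split; lia.
have r_le j : (r j <= (q ^ 2).+1)%N by exact: leqW (ltnW (r_lt j)).
have [F [G [TE Fl Gl]]] := tensor_ring_cut r_le u abm.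
have rab : (#|{: 'I_(r (position a)) * 'I_(r (position b))}| < q ^ 4)%N.
  rewrite card_prod !card_ord (expnD q 2 2); have := r_lt (position a); have := r_lt (position b).
  by move=> ? ?; apply: ltn_mul.
apply: leq_ltn_trans rab.
have [d13 d14 d23 d24] : [/\ i1 != i3, i1 != i4, i2 != i3 & i2 != i4].
  by move: ui; rewrite /= !inE !negb_or => /and4P[/and3P[_ -> ->] /andP[-> ->]].
pose l x1 x2 := dfwith (dfwith y i1 x1) i2 x2.
pose h x3 x4 := dfwith (dfwith y i3 x3) i4 x4.
have slice_l x1 x2 x3 x4 i : i != i3 -> i != i4 ->
    dfwith (dfwith (dfwith (dfwith y i1 x1) i2 x2) i3 x3) i4 x4 i = l x1 x2 i.
  by rewrite eq_sym => n3; rewrite eq_sym => n4; rewrite (dfwithout _ _ n4) (dfwithout _ _ n3).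
have slice_h x1 x2 x3 x4 i : i != i1 -> i != i2 ->
    dfwith (dfwith (dfwith (dfwith y i1 x1) i2 x2) i3 x3) i4 x4 i = h x3 x4 i.
  rewrite eq_sym => n1; rewrite eq_sym => n2; rewrite /h; have [e4|e4] := eqVneq i4 i.
    by subst i; rewrite !dfwithin.
  rewrite !(dfwithout _ _ e4); have [e3|e3] := eqVneq i3 i.
    by subst i; rewrite !dfwithin.
  by rewrite !(dfwithout _ _ e3) (dfwithout _ _ n2) (dfwithout _ _ n1).
case: side => -[s1 s2 s3 s4].
  apply: (@mxrank_sum_products _ _ _ _ _
    (fun a s => F s (l (enum_val a).1 (enum_val a).2))
    (fun s b => G s (h (enum_val b).1 (enum_val b).2))) => c d.
  rewrite mxE /slice TE; apply: eq_bigr => s _; congr (_ * _).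
    apply: Fl => i iab; apply: slice_l.
      by apply: contraTneq iab => ->.
    by apply: contraTneq iab => ->.
  apply: Gl => i iab; apply: slice_h.
    by apply: contraNneq iab => ->.
  by apply: contraNneq iab => ->.
apply: (@mxrank_sum_products _ _ _ _ _
    (fun a s => G s (l (enum_val a).1 (enum_val a).2))
    (fun s b => F s (h (enum_val b).1 (enum_val b).2))) => c d.
rewrite mxE /slice TE; apply: eq_bigr => s _; rewrite mulrC; congr (_ * _).
  apply: Gl => i iab; apply: slice_l.
    by apply: contraNneq iab => ->.
  by apply: contraNneq iab => ->.
apply: Fl => i iab; apply: slice_h.
  by apply: contraTneq iab => ->.
by apply: contraTneq iab => ->.
Qed.

End LowRank.

Section Witness.
Context {R : realType} {m : nat} (n r : 'I_m.+1 -> nat) (tau : 'S_m.+1) (q : nat).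
Hypothesis r_lt : forall j, (r j < q ^ 2)%N.
Hypothesis r_ge : forall j, (q <= r j)%N.
Let p i : nat := (tau^-1)%g i.
Let r_le j : (r j <= (q ^ 2).+1)%N.
Proof. exact: leqW (ltnW (r_lt j)). Qed.

Local Notation K := (q ^ 2)%N.

(** The matrix unit at row a and column b, when v = a * q + b with a, b < q. *)
Definition unit_core (v : nat) : 'M[R]_K.+1 :=
  \matrix_(a, b) [&& (a < q)%N, (b < q)%N & v == (a * q + b)%N]%:R.

(** The identity of size q, bordered with zeros. *)
Definition link : 'M[R]_K.+1 := \matrix_(a, b) ((a == b) && (a < q)%N)%:R.

(** Cores for which a crossing matricization has rank q ^ 4: matrix units at the
    labels in S, and the identity of size q elsewhere. *)
Definition witness (S : seq 'I_m.+1) (z : core_entry n r tau) : R :=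
  let: existT i (a, x, b) := z in
  if i \in S then [&& (a < q)%N, (b < q)%N & x == (a * q + b)%N :> nat]%:R
  else ((a == b :> nat) && (a < q)%N)%:R.

Lemma ring_coreE (u : core_entry n r tau -> R) x j a b :
  ring_core u x j a b = u (existT _ (tau j)
    (cast_ord (esym (congr1 r (permK tau j))) a, x (tau j),
     cast_ord (esym (congr1 (fun k => r (ordS k)) (permK tau j))) b)).
Proof. by rewrite /ring_core castmxE mxE. Qed.

Lemma padded_witness S x j : padded_core (q ^ 2) (witness S) x j =
  if tau j \in S then unit_core (x (tau j)) else link.
Proof.
apply/matrixP => c d.
have [rc|rc] := leqP (r j) c.
  rewrite padded_core_outl //.
  have qc : (c < q)%N = false by apply: negbTE; rewrite -leqNgt (leq_trans (r_ge j)).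
  by case: ifP => _; rewrite mxE qc ?andbF.
have [rd|rd] := leqP (r (ordS j)) d.
  rewrite padded_core_outr //.
  have qd : (d < q)%N = false by apply: negbTE; rewrite -leqNgt (leq_trans (r_ge (ordS j))).
  by case: ifP => _; rewrite mxE ?qd ?andbF //; case: eqVneq => // ->; rewrite qd.
rewrite (@padded_coreE _ _ _ _ _ _ _ _ _ (Ordinal rc) (Ordinal rd)) // ring_coreE /witness /=.
by case: ifP => _; rewrite mxE.
Qed.

Lemma link_unit v : link * unit_core v = unit_core v.
Proof.
apply/matrixP => a b; rewrite !mxE (bigD1 a) //= big1 ?addr0.
  by rewrite !mxE eqxx -natrM mulnb; case: (a < q)%N; rewrite ?andbT ?andbF.
by move=> c ca; rewrite !mxE (eq_sym a) (negPf ca) mul0r.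
Qed.

Lemma unit_link v : unit_core v * link = unit_core v.
Proof.
apply/matrixP => a b; rewrite !mxE (bigD1 b) //= big1 ?addr0.
  rewrite !mxE eqxx -natrM mulnb; congr (nat_of_bool _)%:R.
  by case: (b < q)%N; rewrite ?andbT ?andbF.
by move=> c ca; rewrite !mxE (negPf ca) mulr0.
Qed.

Let lift (a : 'I_q) : 'I_K.+1 := inord a.

Let lift_val a : lift a = a :> nat.
Proof.
rewrite inordK // ltnS (leq_trans (ltnW (ltn_ord a))) // -{1}(expn1 q).
by rewrite leq_pexp2l //; case: (q) a => // -[].
Qed.

Lemma unit_core_delta (a b : 'I_q) : unit_core (a * q + b) = delta_mx (lift a) (lift b).
Proof.
have q0 : (0 < q)%N by case: (q) a => // -[].
apply/matrixP => c d; rewrite !mxE; congr (nat_of_bool _)%:R.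
rewrite -!val_eqE /= !lift_val.
apply/and3P/andP => [[cq dq /eqP e]|[/eqP -> /eqP ->]]; last by rewrite !ltn_ord.
have := congr1 (divn^~ q) e; have := congr1 (modn^~ q) e.
by rewrite !modnMDl !divnMDl // !modn_small // !divn_small // !addn0 => -> ->.
Qed.

Lemma trace_units (a1 b1 a2 b2 a3 b3 a4 b4 : 'I_q) :
  \tr (unit_core (a1 * q + b1) * unit_core (a2 * q + b2) *
       unit_core (a3 * q + b3) * unit_core (a4 * q + b4)) =
  [&& b1 == a2, b2 == a3, b3 == a4 & b4 == a1]%:R.
Proof.
have mulE a b c d : delta_mx (lift a) (lift b) * delta_mx (lift c) (lift d) =
    (b == c)%:R *: delta_mx (lift a) (lift d) :> 'M[R]_K.+1.
  rewrite -mulmxE mul_delta_mx_cond -val_eqE /= !lift_val val_eqE.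
  by case: (b == c); rewrite ?scale1r ?scale0r.
have trE a b : \tr (delta_mx (lift a) (lift b) : 'M[R]_K.+1) = (a == b)%:R.
  rewrite /mxtrace (bigD1 (lift a)) //= big1 ?addr0.
    by rewrite mxE eqxx /= -val_eqE /= !lift_val val_eqE.
  by move=> c ca; rewrite mxE (negPf ca).
rewrite !unit_core_delta mulE -scalerAl mulE scalerA -scalerAl mulE scalerA.
rewrite mxtraceZ trE -!natrM !mulnb (eq_sym a1).
by case: (b1 == a2); case: (b2 == a3); case: (b3 == a4).
Qed.

Lemma witness_arc (S : seq 'I_m.+1) x a b :
  (forall k, (a <= k < b)%N -> tau (position k) \notin S) ->
  arc (q ^ 2) (witness S) x a b = link ^+ (b - a).
Proof.
move=> skip; rewrite -prodr_const_nat; apply: eq_big_nat => k /skip kS.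
by rewrite padded_witness (negPf kS).
Qed.

Lemma unit_linkX v k : unit_core v * link ^+ k = unit_core v.
Proof. by elim: k => [|k IH]; rewrite ?mulr1 // exprS mulrA unit_link. Qed.

Lemma link_unitX v k : link ^+ k * unit_core v = unit_core v.
Proof. by elim: k => [|k IH]; rewrite ?mul1r // exprSr -mulrA link_unit. Qed.

(** Only the four distinguished cores depend on the indices, and the links between
    them are absorbed by their neighbours. *)
Lemma witness_ring (S : seq 'I_m.+1) x i1 i2 i3 i4 :
  S =i [:: i1; i2; i3; i4] -> (p i1 < p i2 < p i3)%N -> (p i3 < p i4)%N ->
  tensor_ring (witness S) x =
  \tr (unit_core (x i1) * unit_core (x i2) * unit_core (x i3) * unit_core (x i4)).
Proof.
move=> SE /andP[p12 p23] p34; have pm i : (p i < m.+1)%N := ltn_ord _.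
have pE i : tau (position (p i)) = i by rewrite positionE permKV.
have inS k : (k < m.+1)%N ->
    (tau (position k) \in S) = [|| k == p i1, k == p i2, k == p i3 | k == p i4].
  move=> km; have tE i : (tau (position k) == i) = (k == p i).
    apply/eqP/eqP => [<-|->]; last exact: pE.
    by rewrite /p permK position_val.
  by rewrite SE !inE !tE.
have step a i : (a <= p i)%N ->
    arc (q ^ 2) (witness S) x a (p i).+1 =
    arc (q ^ 2) (witness S) x a (p i) * (if i \in S then unit_core (x i) else link).
  by move=> ai; rewrite /arc big_nat_recr //= padded_witness pE.
have memS : [/\ i1 \in S, i2 \in S, i3 \in S & i4 \in S].
  by rewrite !SE !inE !eqxx ?orbT.
have [S1 S2 S3 S4] := memS.
rewrite (tensor_ringE r_le) (arc_cat _ _ _ (leq0n (p i4).+1)) ?pm //.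
rewrite (arc_cat _ _ _ (leq0n (p i3).+1)) ?ltnS 1?ltnW //.
rewrite (arc_cat _ _ _ (leq0n (p i2).+1)) ?ltnS 1?ltnW //.
rewrite (arc_cat _ _ _ (leq0n (p i1).+1)) ?ltnS 1?ltnW //.
rewrite !step // S1 S2 S3 S4.
rewrite !witness_arc; try by move=> k kb; rewrite inS; have := pm i4; lia.
by rewrite !mulmxE link_unitX -!mulrA unit_linkX !(mulrA (link ^+ _)) !link_unitX.
Qed.

End Witness.

Section GenericRank.
Context {R : realType} {m : nat} (n r : 'I_m.+1 -> nat) (tau : 'S_m.+1) (q : nat).
Hypothesis r_lt : forall j, (r j < q ^ 2)%N.
Hypothesis r_ge : forall j, (q <= r j)%N.
Hypothesis n_ge : forall i, (q ^ 2 <= n i)%N.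
Implicit Types (T : multi_index n -> R) (y : multi_index n) (i : 'I_m.+1).
Let p i : nat := (tau^-1)%g i.

(** Two pairs of digits in base q, one for each index of a pair. *)
Definition quad : finType := (('I_q * 'I_q) * ('I_q * 'I_q))%type.

Lemma card_quad : #|quad| = (q ^ 4)%N.
Proof. by rewrite !card_prod !card_ord !mulnn -expnM. Qed.

(** Some square submatrix of the matricization is the identity of size q ^ 4. *)
Definition unit_minor T y i1 i2 i3 i4 := exists
  (f1 : quad -> 'I_(n i1)) (f2 : quad -> 'I_(n i2))
  (f3 : quad -> 'I_(n i3)) (f4 : quad -> 'I_(n i4)),
  forall s t, slice T y (f1 s) (f2 s) (f3 t) (f4 t) = (s == t)%:R.

Lemma unit_minor_swapl T y i1 i2 i3 i4 : i1 != i2 ->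
  unit_minor T y i2 i1 i3 i4 -> unit_minor T y i1 i2 i3 i4.
Proof.
move=> h [f1 [f2 [f3 [f4 fP]]]]; exists f2, f1, f3, f4 => s t.
by rewrite -fP /slice (dfwithC _ _ _ h).
Qed.

Lemma unit_minor_swapr T y i1 i2 i3 i4 : i3 != i4 ->
  unit_minor T y i1 i2 i4 i3 -> unit_minor T y i1 i2 i3 i4.
Proof.
move=> h [f1 [f2 [f3 [f4 fP]]]]; exists f1, f2, f4, f3 => s t.
by rewrite -fP /slice (dfwithC _ _ _ h).
Qed.

Lemma unit_minor_trans T y i1 i2 i3 i4 : uniq [:: i1; i2; i3; i4] ->
  unit_minor T y i3 i4 i1 i2 -> unit_minor T y i1 i2 i3 i4.
Proof.
rewrite /= !inE !negb_or => /and4P[/and3P[_ h13 h14] /andP[h23 h24] _ _].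
move=> [f1 [f2 [f3 [f4 fP]]]]; exists f3, f4, f1, f2 => s t.
rewrite eq_sym -fP /slice (dfwithC _ _ _ h23) (dfwithC _ _ _ h13).
by rewrite (dfwithC _ _ _ h24) (dfwithC _ _ _ h14).
Qed.

Lemma code_lt i (a b : 'I_q) : (a * q + b < n i)%N.
Proof.
apply: leq_trans (n_ge i); rewrite -mulnn.
have h : (a.+1 * q <= q * q)%N by rewrite leq_mul2r ltn_ord orbT.
by apply: leq_trans h; rewrite mulSn [ltnRHS]addnC ltn_add2l.
Qed.

Definition code i (a b : 'I_q) : 'I_(n i) := Ordinal (code_lt i a b).

(** When the row labels i1, i2 and the column labels i3, i4 alternate, the trace of
    four matrix units is nonzero only if the digits agree around the ring, so
    that each digit of the row index is matched with a digit of the column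
    index. *)
Lemma unit_minor_alternating S y i1 i2 i3 i4 : S =i [:: i1; i2; i3; i4] ->
  (p i1 < p i3 < p i2)%N -> (p i2 < p i4)%N ->
  unit_minor (tensor_ring (@witness R m n r tau q S)) y i1 i2 i3 i4.
Proof.
move=> SE /andP[p13 p32] p24.
have ne i j : (p i < p j)%N -> (i != j) && (j != i).
  by move=> h; rewrite (eq_sym j) andbb; apply: contraTneq h => ->; rewrite ltnn.
have /andP[n13 n31] := ne _ _ p13; have /andP[n32 n23] := ne _ _ p32.
have /andP[n24 n42] := ne _ _ p24; have p12 := ltn_trans p13 p32.
have /andP[n12 n21] := ne _ _ p12; have /andP[n14 n41] := ne _ _ (ltn_trans p12 p24).
have /andP[n34 n43] := ne _ _ (ltn_trans p32 p24).
exists (fun s => code i1 s.1.1 s.1.2), (fun s => code i2 s.2.1 s.2.2),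
  (fun t => code i3 t.1.2 t.2.1), (fun t => code i4 t.2.2 t.1.1) => s t.
rewrite /slice (@witness_ring _ _ _ _ _ _ r_lt r_ge _ _ i1 i3 i2 i4); first last.
- by [].
- by rewrite -/(p _) p13 p32.
- by move=> i; rewrite SE !inE; do 4 case: (_ == _).
rewrite !(dfwithin, dfwithout) //.
rewrite /= trace_units; congr (nat_of_bool _)%:R.
case: s t => [[a b] [c d]] [[a' b'] [c' d']] /=.
by rewrite !xpair_eqE /= (eq_sym c') (eq_sym a'); do 4 case: (_ == _).
Qed.

Lemma unit_minor_crossing S y i1 i2 i3 i4 : S =i [:: i1; i2; i3; i4] ->
  uniq [:: i1; i2; i3; i4] -> crossing (p i1) (p i2) (p i3) (p i4) ->
  unit_minor (tensor_ring (@witness R m n r tau q S)) y i1 i2 i3 i4.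
Proof.
wlog p12 : i1 i2 / (p i1 < p i2)%N => [W SE ui cr|].
  have h12 : i1 != i2 by move: ui; rewrite /= !inE !negb_or; case/and4P => /and3P[].
  case: (ltngtP (p i1) (p i2)) => [lt|lt|/val_inj/perm_inj/eqP]; last by rewrite (negPf h12).
    exact: W.
  apply: (unit_minor_swapl h12); apply: W => //.
  - by move=> i; rewrite SE !inE; do 4 case: (_ == _).
  - by move: ui; rewrite /= !inE !negb_or (eq_sym i2 i1) => /and4P[/and3P[-> -> ->] /andP[-> ->] -> _].
  rewrite -crossing_swapl // in cr.
  by rewrite -(map_inj_uniq (f := p)) // in ui => i j /val_inj/perm_inj.
wlog p34 : i3 i4 / (p i3 < p i4)%N => [W SE ui cr|].
  have h34 : i3 != i4 by move: ui; rewrite /= !inE !negb_or; case/and4P.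
  case: (ltngtP (p i3) (p i4)) => [lt|lt|/val_inj/perm_inj/eqP]; last by rewrite (negPf h34).
    exact: W.
  apply: (unit_minor_swapr h34); apply: W => //.
  - by move=> i; rewrite SE !inE; do 4 case: (_ == _).
  - by move: ui; rewrite /= !inE !negb_or (eq_sym i4 i3) => /and4P[/and3P[-> -> ->] /andP[-> ->] -> _].
  by move: cr; rewrite /crossing eq_sym.
move=> SE ui cr; have : [&& p i1 < p i3, p i3 < p i2 & p i2 < p i4]%N ||
  [&& p i3 < p i1, p i1 < p i4 & p i4 < p i2]%N.
  have : uniq [:: p i1; p i2; p i3; p i4].
    by rewrite -(map_inj_uniq (f := p)) // in ui => i j /val_inj/perm_inj.
  rewrite /= !inE !negb_or; move: p12 p34 cr; rewrite /crossing /cyc.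
  move: (p i1) (p i2) (p i3) (p i4) => a b c d; clear; lia.
case/orP => /and3P[h1 h2 h3]; first by apply: unit_minor_alternating; rewrite // h1 h2.
apply: unit_minor_trans => //; apply: unit_minor_alternating; rewrite ?h1 ?h2 //.
by move=> i; rewrite SE !inE; do 4 case: (_ == _).
Qed.

Lemma polyfun_tensor_ring x : polyfun (fun u : core_entry n r tau -> R => tensor_ring u x).
Proof.
have prodP k a b : polyfun (fun u : core_entry n r tau -> R => ring_prod u x k a b).
  elim: k a b => [|k IH] a b; first exact: polyfun_const.
  apply: polyfun_mulmx => // c d.
  rewrite (_ : (fun _ => _) = fun u => u (existT _ (tau (iter k (@ordS m.+1) ord0))
      (cast_ord (esym (congr1 r (permK tau _))) c, x _,
       cast_ord (esym (congr1 (fun k => r (ordS k)) (permK tau _))) d))).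
    exact: polyfun_coord.
  by apply/funext => u; rewrite ring_coreE.
apply: polyfun_sum => a.
rewrite (_ : (fun _ => _) = fun u => ring_prod u x m.+1 (cast_ord (esym erefl) a)
   (cast_ord (esym (congr1 r (iter_ordS_full m))) a)); first exact: prodP.
by apply/funext => u; rewrite castmxE.
Qed.

(** The minor which is 1 at the witness is a polynomial in the cores, and the
    matricization has rank at least q ^ 4 wherever it does not vanish. *)
Lemma generic_minor y i1 i2 i3 i4 : uniq [:: i1; i2; i3; i4] ->
  crossing (p i1) (p i2) (p i3) (p i4) ->
  exists F : (core_entry n r tau -> R) -> R,
  [/\ polyfun F, exists u, F u != 0 &
      forall u, F u != 0 -> (q ^ 4 <= \rank (mx12_34 (tensor_ring u) y i1 i2 i3 i4))%N].
Proof.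
move=> ui cr; have [f1 [f2 [f3 [f4 fP]]]] :=
  @unit_minor_crossing [:: i1; i2; i3; i4] y i1 i2 i3 i4 (fun=> erefl) ui cr.
pose f (k : 'I_#|quad|) : 'I_#|{: 'I_(n i1) * 'I_(n i2)}| :=
  enum_rank (f1 (enum_val k), f2 (enum_val k)).
pose g (k : 'I_#|quad|) : 'I_#|{: 'I_(n i3) * 'I_(n i4)}| :=
  enum_rank (f3 (enum_val k), f4 (enum_val k)).
pose M (u : core_entry n r tau -> R) := mxsub f g (mx12_34 (tensor_ring u) y i1 i2 i3 i4).
have ME u k l : M u k l = slice (tensor_ring u) y (f1 (enum_val k)) (f2 (enum_val k))
    (f3 (enum_val l)) (f4 (enum_val l)).
  by rewrite !mxE !enum_rankK.
exists (fun u => \det (M u)); split.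
- apply: polyfun_det => k l.
  rewrite (_ : (fun _ => _) = fun u => tensor_ring u
    (dfwith (dfwith (dfwith (dfwith y i1 (f1 (enum_val k))) i2 (f2 (enum_val k)))
       i3 (f3 (enum_val l))) i4 (f4 (enum_val l)))).
    exact: polyfun_tensor_ring.
  by apply/funext => u; exact: ME.
- exists (witness q [:: i1; i2; i3; i4]); rewrite (_ : M _ = 1%:M) ?det1 ?oner_eq0 //.
  apply/matrixP => k l; rewrite ME fP mxE; congr (nat_of_bool _)%:R.
  exact: (inj_eq enum_val_inj).
move=> u; rewrite -unitfE -unitmxE => uM.
rewrite -card_quad -(mxrank_unit uM); exact: mxrank_mxsub.
Qed.

End GenericRank.

Section FourIndexCorrect.
Context {R : realType} {m : nat} (n r : 'I_m.+1 -> nat) (tau : 'S_m.+1) (q : nat).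
Variable u : core_entry n r tau -> R.
Let p i : nat := (tau^-1)%g i.
Hypothesis q_gt0 : (0 < q)%N.
Hypothesis rankE : forall y i1 i2 i3 i4, uniq [:: i1; i2; i3; i4] ->
  (q ^ 4 <= \rank (mx12_34 (tensor_ring u) y i1 i2 i3 i4))%N =
  crossing (p i1) (p i2) (p i3) (p i4).

Lemma four_index_crossing y i1 i2 i3 i4 : uniq [:: i1; i2; i3; i4] ->
  four_index (tensor_ring u) q y i1 i2 i3 i4 = Some
   (if crossing (p i1) (p i2) (p i3) (p i4) then [:: i1; i3; i2; i4]
    else if crossing (p i1) (p i3) (p i2) (p i4) then [:: i1; i2; i3; i4]
    else [:: i1; i2; i4; i3]).
Proof.
move=> ui; rewrite /four_index mx13_24E // mx14_23E //.
have ui3 : uniq [:: i1; i3; i2; i4].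
  by move: ui; rewrite /= !inE !negb_or (eq_sym i3 i2) => /and4P[/and3P[-> -> ->] /andP[-> ->] -> _].
have ui4 : uniq [:: i1; i4; i2; i3].
  move: ui; rewrite /= !inE !negb_or (eq_sym i4 i2) (eq_sym i4 i3).
  by move=> /and4P[/and3P[-> -> ->] /andP[-> ->] -> _].
have sE y' j1 j2 j3 j4 : uniq [:: j1; j2; j3; j4] ->
    (0 < sigma (q ^ 4) (mx12_34 (tensor_ring u) y' j1 j2 j3 j4)) =
    crossing (p j1) (p j2) (p j3) (p j4).
  by move=> uj; rewrite sigma_gt0 ?expn_gt0 ?q_gt0 // rankE.
have := sE y _ _ _ _ ui; have := sE y _ _ _ _ ui3; have := sE y _ _ _ _ ui4.
have up : uniq [:: p i1; p i2; p i3; p i4].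
  by rewrite -(map_inj_uniq (f := p)) // in ui => i j /val_inj/perm_inj.
have c3 := crossing_third up; have c1 := crossing_only up.
have := sigma_ge0 (q ^ 4) (mx12_34 (tensor_ring u) y i1 i2 i3 i4).
have := sigma_ge0 (q ^ 4) (mx12_34 (tensor_ring u) y i1 i3 i2 i4).
have := sigma_ge0 (q ^ 4) (mx12_34 (tensor_ring u) y i1 i4 i2 i3).
move: (sigma _ _) (sigma _ _) (sigma _ _) => a b c c0 b0 a0 Ec Eb Ea.
move: c1 c3; rewrite -Ea -Eb -Ec; case: (ltP 0 a) => ha; case: (ltP 0 b) => hb;
  case: (ltP 0 c) => hc //=; try by [move=> /(_ isT)|move=> _ /(_ isT isT)]; move=> _ _.
- by rewrite gt_max (le_lt_trans hb ha) (le_lt_trans hc ha).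
- by rewrite !gt_max (le_gtF (le_trans ha b0)) (le_lt_trans ha hb) (le_lt_trans hc hb).
rewrite !gt_max (le_gtF (le_trans ha b0)) (le_gtF (le_trans hb c0)) andbF.
by rewrite (le_lt_trans ha hc) (le_lt_trans hb hc).
Qed.

End FourIndexCorrect.

(** * Recovery outside a null set *)

Local Open Scope classical_set_scope.

Theorem corollary4p3 (R : realType) (m : nat) (n r : 'I_m.+1 -> nat) (q : nat)
    (d_ge4 : (4 <= m.+1)%N)
    (n_gt0 : forall i, (0 < n i)%N) (r_gt0 : forall j, (0 < r j)%N)
    (q_gt0 : (0 < q)%N)
    (n_ge : forall i, (q ^ 2 <= n i)%N)
    (r_lt : forall j, (r j < q ^ 2)%N)
    (r_ge : forall j, (q <= r j)%N)
    (tau : 'S_m.+1) :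
  exists N : set (core_entry n r tau -> R),
    lebesgue_outer_measure N = 0%E /\
    forall u : core_entry n r tau -> R, ~ N u ->
    forall Y : nat -> multi_index n,
      (exists tau' : 'S_m.+1, ring_recovery (tensor_ring u) q Y tau') /\
      (forall tau' : 'S_m.+1,
         ring_recovery (tensor_ring u) q Y tau' -> tau' \in CS_TR tau).
Proof.
pose p i : nat := (tau^-1)%g i.
(* The possible calls of the Four-Index Algorithm are finite in number. *)
pose call : finType := ({dffun forall i : 'I_m.+1, 'I_(n i)} *
  ('I_m.+1 * 'I_m.+1 * 'I_m.+1 * 'I_m.+1))%type.
have /choice[F FP] : forall c : call, exists F : (core_entry n r tau -> R) -> R,
    let: (y, (i1, i2, i3, i4)) := c in
    [/\ polyfun F, exists u, F u != 0 &
      uniq [:: i1; i2; i3; i4] -> crossing (p i1) (p i2) (p i3) (p i4) ->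
      forall u, F u != 0 ->
      (q ^ 4 <= \rank (mx12_34 (tensor_ring u) y i1 i2 i3 i4))%N].
  case=> y [[[i1 i2] i3] i4].
  have [/andP[ui cr]|nc] :=
    boolP (uniq [:: i1; i2; i3; i4] && crossing (p i1) (p i2) (p i3) (p i4)).
    by have [F [Fp F0 FP]] := @generic_minor R m n r tau q r_lt r_ge n_ge y _ _ _ _ ui cr;
      exists F.
  exists (fun=> 1); split; first exact: polyfun_const.
    by exists (fun=> 0); rewrite oner_neq0.
  by move=> ui cr; rewrite ui cr in nc.
exists (\bigcup_c [set u | F c u = 0]); split.
  apply: null_zero_sets.
  - apply/card_gt0P; pose i := tau ord0.
    by exists (existT _ i (Ordinal (r_gt0 _), Ordinal (n_gt0 i), Ordinal (r_gt0 _))).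
  - by move=> c; have := FP c; case: c => y [[[i1 i2] i3] i4] [].
  by move=> c; have := FP c; case: c => y [[[i1 i2] i3] i4] [].
move=> u Nu Y; apply: ring_recovery_correct => // y i1 i2 i3 i4.
apply: four_index_crossing => // {}y {}i1 {}i2 {}i3 {}i4 ui.
apply/idP/idP => [|cr]; first by apply: contraTT => ncr; rewrite -ltnNge mxrank_low.
pose y' : {dffun forall i : 'I_m.+1, 'I_(n i)} := [ffun i => y i].
have -> : y = y' by apply: functional_extensionality_dep => i; rewrite ffunE.
have [_ _] := FP (y', (i1, i2, i3, i4)); apply => //.
by apply/eqP => F0; apply: Nu; exists (y', (i1, i2, i3, i4)).
Qed.
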